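(* Let $n\ge3$ and $T_n=\{(a,b,c)\in\mathbb N^3 : 1\le a<b<c\le n\}$. For every $M\in N_n^+$ and any $s_1,s_2,s_3,s_4\in S_3$, $$\sum_{(a,b,c)\in T_n} l\Bigl(\bigl(Y_{abc}(s_1(M))\bigr)^{\mathrm{sgn}(s_1)}\Bigr)=\sum_{(a,b,c)\in T_n} l\Bigl(\bigl(\tilde Y^{abc}(s_2(M))\bigr)^{\mathrm{sgn}(s_2)}\Bigr)$$ $$=\sum_{(a,b,c)\in T_n} l\Bigl(\bigl(\tilde Y_{abc}(s_3(M))\bigr)^{\mathrm{sgn}(s_3)}\Bigr)=\sum_{(a,b,c)\in T_n} l\Bigl(\bigl(Y^{abc}(s_4(M))\bigr)^{\mathrm{sgn}(s_4)}\Bigr).$$ Here $s(M)$ is defined by $id(M)=M$, $\sigma_1(M)=M'$, $\sigma_2(M)=M''$, $(\sigma_2\sigma_1)(M)=(M')''$, $(\sigma_1\sigma_2)(M)=(M'')'$, $(\sigma_1\sigma_2\sigma_1)(M)=((M')'')'$, $(\sigma_2\sigma_1\sigma_2)(M)=((M'')')''$, and for the element $\sigma_1\sigma_2\sigma_1=\sigma_2\sigma_1\sigma_2$ the identities hold for either of the two choices $s(M)=((M')'')'$ and $s(M)=((M'')')''$ (independently at each of the four places).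
   Context: Dilogarithm: for $x\in(0,1)$ the Rogers dilogarithm is $L(x)=\mathrm{Li}_2(x)+\frac12\log x\,\log(1-x)$, and for $x>0$ one sets $l(x)=\frac{6}{\pi^2}L\bigl(\frac{x}{1+x}\bigr)$. Matrices: $B_n$ is the group of $n\times n$ real invertible upper triangular matrices and $N_n\subset B_n$ its unipotent subgroup (ones on the diagonal). $G\in B_n$ is totally positive if every minor of $G$ that does not vanish identically (as a function on $B_n$) is positive. $N_n^+\subset N_n$ is the subset of totally positive matrices. Maps $M\mapsto M'$, $M\mapsto M''$: let $P$ be the $n\times n$ matrix with $P_{ij}=\delta_{i+j,n+1}$. For every $M\in N_n^+$ there exist unique $M',M''\in N_n^+$ and a unique diagonal matrix $D_M$ such that $PMP=M'PD_MM''$; this defines $M'$ and $M''$. Symmetric group: $\sigma_1,\sigma_2$ are generators of $S_3$ satisfying $\sigma_1\sigma_1=\sigma_2\sigma_2=id$, $\sigma_1\sigma_2\sigma_1=\sigma_2\sigma_1\sigma_2$; $\mathrm{sgn}(s)=\pm1$ is the sign, so $\mathrm{sgn}(\sigma_1)=\mathrm{sgn}(\sigma_2)=-1$. Flag minors: $[a,b]=\{i\in\mathbb N: a\le i\le b\}$ (empty if $a>b$). For $I,J\subset[1,n]$, $\Delta_I$ is the minor on the rows labeled by $I$ and the last $|I|$ columns; $\Delta^J$ is the minor on the first $|J|$ rows and the columns labeled by $J$; $\Delta_\emptyset=\Delta^\emptyset=1$. Y-variables, for $1\le a<b<c\le n$ (all minors are those of $M$): $$Y_{abc}(M)=\frac{\Delta_{[a,b-1]\cup[c+1,n]}\,\Delta_{[a+1,b]\cup[c,n]}}{\Delta_{[a,b]\cup[c+1,n]}\,\Delta_{[a+1,b-1]\cup[c,n]}},\qquad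 \tilde Y_{abc}(M)=\frac{\Delta_{[1,a]\cup[b+1,c-1]}\,\Delta_{[1,a-1]\cup[b,c]}}{\Delta_{[1,a]\cup[b,c-1]}\,\Delta_{[1,a-1]\cup[b+1,c]}},$$ $$Y^{abc}(M)=\frac{\Delta^{[a,b]\cup[c+1,n]}\,\Delta^{[a+1,b-1]\cup[c,n]}}{\Delta^{[a,b-1]\cup[c+1,n]}\,\Delta^{[a+1,b]\cup[c,n]}},\qquad \tilde Y^{abc}(M)=\frac{\Delta^{[1,a]\cup[b,c-1]}\,\Delta^{[1,a-1]\cup[b+1,c]}}{\Delta^{[1,a]\cup[b+1,c-1]}\,\Delta^{[1,a-1]\cup[b,c]}}.$$ *)

(* Defs.v *)
From HB Require Import structures.
From mathcomp Require Import all_boot all_order all_algebra all_fingroup.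
From mathcomp Require Import all_classical all_reals all_analysis.
Set Implicit Arguments.
Unset Strict Implicit.
Unset Printing Implicit Defensive.
Import Order.TTheory GRing.Theory Num.Theory.
Import numFieldNormedType.Exports.
Local Open Scope classical_set_scope.
Local Open Scope ring_scope.

Section Dilogarithm.
Variable R : realType.
Implicit Type x : R.

(* The series converges, and so has its usual meaning, for |x| <= 1. *)
Definition Li2 x : R := limn (series (fun k => x ^+ k.+1 / k.+1%:R ^+ 2)).

Definition rogersL x : R := Li2 x + 2^-1 * ln x * ln (1 - x).

Definition ldilog x : R := 6 / pi ^+ 2 * rogersL (x / (1 + x)).

End Dilogarithm.

Section TotallyPositive.
Variables (R : realType) (n : nat).
Implicit Types G M : 'M[R]_n.

Definition Bgroup : set 'M[R]_n := [set G | is_trig_mx G^T /\ G \in unitmx].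

Definition Ngroup : set 'M[R]_n := [set G | Bgroup G /\ forall i, G i i = 1].

Definition minor k (f g : 'I_k -> 'I_n) M : R := \det (mxsub f g M).

Definition totally_positive G :=
  forall k (f g : 'I_k -> 'I_n),
    {homo f : i j / (i < j)%N} -> {homo g : i j / (i < j)%N} ->
    (exists2 H, Bgroup H & minor f g H != 0) -> 0 < minor f g G.

Definition Nplus : set 'M[R]_n := [set M | Ngroup M /\ totally_positive M].

(* Rows and columns are numbered from 1 in the mathematics, from 0 in 'I_n. *)
Definition antidiag : 'M[R]_n := \matrix_(i, j) (i.+1 + j.+1 == n.+1)%N%:R.

(* The pairs (M', M''); for M in Nplus there is exactly one. *)
Definition factor_pair M : set ('M[R]_n * 'M[R]_n) :=
  [set A | [/\ Nplus A.1, Nplus A.2 & exists d : 'rV[R]_n,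
     antidiag *m M *m antidiag = A.1 *m antidiag *m diag_mx d *m A.2]].

Definition prime1 M : 'M[R]_n := (xget (1%:M, 1%:M) (factor_pair M)).1.
Definition prime2 M : 'M[R]_n := (xget (1%:M, 1%:M) (factor_pair M)).2.

End TotallyPositive.

Section SymmetricGroup.

Definition sigma1 : 'S_3 := tperm (inord 0) (inord 1).
Definition sigma2 : 'S_3 := tperm (inord 1) (inord 2).

Definition sgn (s : 'S_3) : int := (-1) ^+ s.

(* s_image M s A means that A is a value of s(M): there is one value, except
   for the longest element, for which there are two a priori distinct ones. *)
Inductive s_image (R : realType) n (M : 'M[R]_n) : 'S_3 -> 'M[R]_n -> Prop :=
| s_image_id : s_image M 1%g M
| s_image_1 : s_image M sigma1 (prime1 M)
| s_image_2 : s_image M sigma2 (prime2 M)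
| s_image_21 : s_image M (sigma2 * sigma1)%g (prime2 (prime1 M))
| s_image_12 : s_image M (sigma1 * sigma2)%g (prime1 (prime2 M))
| s_image_121 :
    s_image M (sigma1 * sigma2 * sigma1)%g (prime1 (prime2 (prime1 M)))
| s_image_212 :
    s_image M (sigma2 * sigma1 * sigma2)%g (prime2 (prime1 (prime2 M))).

End SymmetricGroup.

Section FlagMinors.
Variables (R : realType) (n : nat).
Implicit Types (I J : {set 'I_n}) (M : 'M[R]_n) (a b c : nat).

Lemma card_set_ord_leq I : (#|I| <= n)%N.
Proof. by rewrite -[leqRHS]card_ord max_card. Qed.

Definition first_ord I : 'I_#|I| -> 'I_n := widen_ord (card_set_ord_leq I).

(* j |-> n - #|I| + j, i.e. the last #|I| elements of 'I_n in order. *)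
Definition last_ord I (j : 'I_#|I|) : 'I_n := rev_ord (first_ord (rev_ord j)).

(* enum_val lists the elements of I in increasing order. *)
Definition DeltaL I M : R :=
  minor (fun i : 'I_#|I| => enum_val i) (@last_ord I) M.
Definition DeltaU J M : R :=
  minor (@first_ord J) (fun j : 'I_#|J| => enum_val j) M.

(* The interval [a, b] of 1-based indices; the truncated b.-1 is harmless. *)
Definition idx_itv a b : {set 'I_n} := [set i : 'I_n | (a <= i.+1 <= b)%N]%SET.

(* YL, tYL, YU, tYU are Y_abc, ~Y_abc, Y^abc, ~Y^abc (L and U recall the lower
   and upper position of the indices). *)
Definition YL a b c M : R :=
  (DeltaL (idx_itv a b.-1 :|: idx_itv c.+1 n) M * DeltaL (idx_itv a.+1 b :|: idx_itv c n) M) /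
  (DeltaL (idx_itv a b :|: idx_itv c.+1 n) M * DeltaL (idx_itv a.+1 b.-1 :|: idx_itv c n) M).

Definition tYL a b c M : R :=
  (DeltaL (idx_itv 1 a :|: idx_itv b.+1 c.-1) M * DeltaL (idx_itv 1 a.-1 :|: idx_itv b c) M) /
  (DeltaL (idx_itv 1 a :|: idx_itv b c.-1) M * DeltaL (idx_itv 1 a.-1 :|: idx_itv b.+1 c) M).

Definition YU a b c M : R :=
  (DeltaU (idx_itv a b :|: idx_itv c.+1 n) M * DeltaU (idx_itv a.+1 b.-1 :|: idx_itv c n) M) /
  (DeltaU (idx_itv a b.-1 :|: idx_itv c.+1 n) M * DeltaU (idx_itv a.+1 b :|: idx_itv c n) M).

Definition tYU a b c M : R :=
  (DeltaU (idx_itv 1 a :|: idx_itv b c.-1) M * DeltaU (idx_itv 1 a.-1 :|: idx_itv b.+1 c) M) /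
  (DeltaU (idx_itv 1 a :|: idx_itv b.+1 c.-1) M * DeltaU (idx_itv 1 a.-1 :|: idx_itv b c) M).

End FlagMinors.

(* T_n; the bound by n is carried by the type 'I_n.+1. *)
Definition triples n : {set 'I_n.+1 * 'I_n.+1 * 'I_n.+1} :=
  [set t : 'I_n.+1 * 'I_n.+1 * 'I_n.+1 |
     [&& 1 <= t.1.1, t.1.1 < t.1.2 & t.1.2 < t.2]%N]%SET.

(* The sum of l (Y_abc(A) ^ e) over T_n, for a family Y of Y-variables. *)
Definition dilog_sum (R : realType) n
    (Y : nat -> nat -> nat -> 'M[R]_n -> R) (A : 'M[R]_n) (e : int) : R :=
  \sum_(t in triples n) ldilog (Y t.1.1 t.1.2 t.2 A ^ e).

(* Main.v *)
Require Import Defs.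
From HB Require Import structures.
From mathcomp Require Import all_boot all_order all_algebra all_fingroup.
From mathcomp Require Import all_classical all_reals all_analysis.
From mathcomp Require Import zify ring lra.
Import Order.TTheory GRing.Theory Num.Theory.
Import numFieldNormedType.Exports.
Set Implicit Arguments.
Unset Strict Implicit.
Unset Printing Implicit Defensive.
Local Open Scope classical_set_scope.
Local Open Scope ring_scope.

(**
All the flag minors that occur in Y_abc are D(a, b, c), the minor on the rows
[a, b) u [c, n), and all those of ~Y_abc are on the rows [0, a) u [b, c). In
both cases 1 + Y_abc factors, by a three-term Plucker relation P + Q = S whose
six factors sit at the vertices of an octahedron in the lattice of triples.
Since 2 dL = log(1 + Y) dlog Y - log Y dlog(1 + Y), the derivative of the sum of
l(Y_abc) along a curve is a sum over octahedra of
P /\ Q + Q /\ S + S /\ P, where f /\ g = log f dlog g - log g dlog f. Parallel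
edges of neighbouring octahedra cancel and only the faces of the box survive;
they carry the minors on the rows [a, b) and on the rows [0, a) u [b, n), for Y
as well as for ~Y. Reflecting M in the antidiagonal exchanges the two faces, and
turns the minors with upper indices into those with lower indices. So all the
four sums differ by constants on N_n^+, any two points of which are joined by a
differentiable path because N_n^+ is a semigroup stable under dilations. The
constant for the reflection is 0 because the reflection is an involution; the
constant between Y and ~Y is computed at the unipotent factor of a Vandermonde
matrix, where both variables are (c - b) / (b - a).

Finally M' has the flag minors of M with the rows reversed, up to a factor that
cancels in the Y-variables, so M |-> M' exchanges Y and 1 / ~Y, and likewise for
M''; and l(y) + l(1 / y) is constant.
*)

(** * The Rogers dilogarithm *)

(** Since M' and M'' are values of a choice operator, nothing is known of them before a
    factorization inside $N_n^+$ has been built. Triangular elimination gives one with unipotent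
    factors; the flag minors of the first factor are ratios of flag minors of M, and Cryer's
    criterion deduces the positivity of all minors from that of the flag minors.

    The telescoping takes place on a whole cube of triples, which is larger than the domain a < b <
    c of the sums. The octahedra off this domain have a degenerate relation and contribute 0, except
    those with a = b = c. For Y these diagonal terms vanish too, but the edge common to the two
    faces leaves a term; for ~Y the edge term vanishes and the diagonal remains. The two remainders
    coincide.

    Minors are determinants of functions on pairs of naturals, with rows and columns listed in
    sequences: inserting, removing, shifting and reversing indices then needs no casts. *)

Section Dilog.
Variable R : realType.
Implicit Types x y : R.

Lemma is_derive1_eq (f : R -> R) x d d' : is_derive x 1 f d -> d = d' -> is_derive x 1 f d'.
Proof. by move=> ? <-. Qed.

Lemma eq_of_derive0 (f : R -> R) (a b : R) : a <= b ->
  (forall x, x \in `[a, b]%R -> is_derive x 1 f 0) -> f a = f b.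
Proof.
move=> ab fd.
have d1 x : x \in `]a, b[%R -> is_derive x 1 f ((fun=> 0) x).
  by move=> xab; apply: fd; apply: subset_itv_oo_cc xab.
have cf : {within `[a, b], continuous f}.
  by apply: derivable_within_continuous => x xab; case: (fd x xab).
have [c _] := MVT_segment ab d1 cf.
by rewrite mul0r => /eqP; rewrite subr_eq0 => /eqP.
Qed.

(* The Taylor coefficients of - ln (1 - x) and of Li2. *)
Let c1 (k : nat) : R := if k is k'.+1 then k%:R^-1 else 0.
Let c2 (k : nat) : R := if k is k'.+1 then k%:R^-1 ^+ 2 else 0.

Lemma cvg_pseries_bounded (c : nat -> R) B x : (forall k, `|c k| <= B) -> `|x| < 1 ->
  cvgn (pseries c x).
Proof.
move=> cB x1; apply: normed_cvg.
apply: (@series_le_cvg _ _ (geometric B `|x|)).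
- by move=> n /=.
- by move=> n /=; rewrite mulr_ge0 ?exprn_ge0 // (le_trans _ (cB 0%N)).
- by move=> n /=; rewrite normrM normrX ler_wpM2r ?exprn_ge0.
- by apply: is_cvg_geometric_series; rewrite normr_id.
Qed.

Lemma c1_diffs : pseries_diffs c1 = fun=> 1.
Proof. by apply/funext => k; rewrite /pseries_diffs /= divff. Qed.

Lemma c2_diffs : pseries_diffs c2 = fun k => k.+1%:R^-1.
Proof.
by apply/funext => k; rewrite /pseries_diffs /= expr2 mulrA divff ?mul1r.
Qed.


Let c1_bound k : `|c1 k| <= 1.
Proof.
case: k => [|k]; first by rewrite normr0.
by rewrite ger0_norm ?invr_ge0 ?ler0n // invf_le1 ?ltr0n // ler1n.
Qed.

Let c2_bound k : `|c2 k| <= 1.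
Proof.
case: k => [|k]; first by rewrite normr0.
by rewrite normrX exprn_ile1 // (c1_bound k.+1).
Qed.

Let d2_bound k : `|k.+1%:R^-1 : R| <= 1.
Proof. exact: (c1_bound k.+1). Qed.

Let dd2_bound k : `|pseries_diffs (fun k => k.+1%:R^-1) k : R| <= 1.
Proof.
rewrite /pseries_diffs ger0_norm ?mulr_ge0 ?invr_ge0 ?ler0n //.
by rewrite ler_pdivrMr ?ltr0n // mul1r ler_nat.
Qed.

(** These are the coefficients of the second derived series of [c1]. They are unbounded, so
    comparison with a geometric series fails; instead the partial sums increase and, by their closed
    form, stay below $(1-x)^{-2}$. *)
Lemma cvg_pseries_succ x : 0 <= x < 1 -> cvgn (pseries (fun k => k.+1%:R) x).
Proof.
move=> /andP[x0 x1]; have y0 : 0 < 1 - x by rewrite subr_gt0.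
apply: nondecreasing_is_cvgn.
  apply/nondecreasing_seqP => n; rewrite /pseries /series /= big_nat_recr //= lerDl.
  by rewrite mulr_ge0 ?ler0n ?exprn_ge0.
exists ((1 - x) ^- 2) => _ [n _ <-].
rewrite -[leRHS]mul1r ler_pdivlMr ?exprn_gt0 //.
have -> : pseries (fun k => k.+1%:R) x n * (1 - x) ^+ 2
    = 1 - n.+1%:R * x ^+ n + n%:R * x ^+ n.+1.
  elim: n => [|n IHn]; first by rewrite /pseries /series /= big_nil; ring.
  rewrite /pseries /series /= big_nat_recr //= mulrDl [X in X + _]IHn !exprS.
  by rewrite -!natr1; ring.
rewrite -addrA gerDl addrC subr_le0 exprS mulrA ler_wpM2r ?exprn_ge0 //.
by rewrite (le_trans (_ : _ <= n%:R)) ?ler_nat // ler_piMr ?ler0n // ltW.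
Qed.

(** The two sequences are shifts of each other, so the same points are limits of both and the chosen
    limits agree even under divergence. Hence [Li2] can be replaced by a power series as a function
    on the whole line. *)
Lemma limn_series0 (u : nat -> R) : u 0%N = 0 ->
  limn (series (fun k => u k.+1)) = limn (series u).
Proof.
move=> u0; have -> : series (fun k => u k.+1) = (fun n => series u n.+1).
  by apply/funext => n; rewrite /series /= big_nat_recl // u0 add0r.
rewrite /lim /lim_in; congr (get _); apply/funext => l; apply/propext.
by rewrite (cvg_shiftS (series u)).
Qed.

Let P c x := limn (pseries c x).

(** Termwise differentiation at x asks for convergence at some K with |x| < |K|. *)
Let mid x : `|x| < 1 -> exists2 K, 0 <= K < 1 & `|x| < `|K|.
Proof.
move=> x1; have x0 := normr_ge0 x; exists ((1 + `|x|) / 2); first by lra.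
by rewrite [ltRHS]ger0_norm; lra.
Qed.

Let P_derive1 x : `|x| < 1 -> is_derive x 1 (P c1) (1 - x)^-1.
Proof.
move=> x1; have [K K01 xK] := mid x1.
have K1 : `|K| < 1 by case/andP: K01 => K0 ?; rewrite ger0_norm.
have -> : (1 - x)^-1 = limn (pseries (pseries_diffs c1) x).
  rewrite c1_diffs; apply/esym/cvg_lim => //.
  have := @cvg_geometric_series R 1 x x1; rewrite mul1r; apply: cvg_trans.
  rewrite (_ : pseries _ _ = series (geometric 1 x)) //.
apply: (@pseries_snd_diffs _ c1 K) => //.
- exact: cvg_pseries_bounded c1_bound _.
- by rewrite c1_diffs; apply: (@cvg_pseries_bounded _ 1) => // k; rewrite normr1.
- rewrite c1_diffs (_ : pseries_diffs _ = fun k => k.+1%:R).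
    exact: cvg_pseries_succ.
  by apply/funext => k; rewrite /pseries_diffs mulr1.
Qed.

Let P0 c : P c 0 = c 0%N.
Proof.
apply/cvg_lim => //; rewrite -(cvg_shiftS (pseries c 0)).
rewrite (_ : (fun _ => _) = cst (c 0%N)); first exact: cvg_cst.
apply/funext => n; rewrite /pseries /series /= big_nat_recl // expr0 mulr1.
by rewrite big1 ?addr0 // => i _; rewrite expr0n mulr0.
Qed.

Lemma pseries_ln x : 0 <= x < 1 -> P c1 x = - ln (1 - x).
Proof.
move=> /andP[x0 x1]; pose f y : R := P c1 y + ln (1 - y).
have fd y : y \in `[0, x]%R -> is_derive y 1 f 0.
  rewrite in_itv /= => /andP[y0 yx]; have y1 := le_lt_trans yx x1.
  have h1 : is_derive y 1 (P c1) (1 - y)^-1 by apply: P_derive1; rewrite ger0_norm.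
  have h2 : 0 < 1 - y by rewrite subr_gt0.
  have h3 := is_derive1_ln h2.
  by apply: is_derive1_eq; ring.
have := eq_of_derive0 x0 fd; rewrite /f P0 subr0 ln1 addr0 => /esym/eqP.
by rewrite addr_eq0 => /eqP.
Qed.

Lemma is_derive_Li2 x : 0 < x < 1 -> is_derive x 1 (@Li2 R) (- ln (1 - x) / x).
Proof.
move=> /andP[x0 x1]; have nx1 : `|x| < 1 by rewrite ger0_norm // ltW.
have [K K01 xK] := mid nx1.
have K1 : `|K| < 1 by case/andP: K01 => K0 ?; rewrite ger0_norm.
have -> : @Li2 R = P c2.
  apply/funext => y; rewrite /Li2 /P /pseries.
  rewrite -(@limn_series0 (fun k => c2 k * y ^+ k)) /= ?mul0r //.
  congr (limn (series _)); apply/funext => k.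
  by rewrite mulrC exprVn.
have -> : - ln (1 - x) / x = limn (pseries (pseries_diffs c2) x).
  apply: (mulIf (lt0r_neq0 x0)); rewrite mulfVK ?lt0r_neq0 //.
  rewrite -pseries_ln ?ltW // c2_diffs /P /pseries.
  rewrite -(@limn_series0 (fun k => c1 k * x ^+ k)) /= ?mul0r //.
  have Cd := cvg_pseries_bounded d2_bound nx1.
  rewrite mulrC; apply/cvg_lim => //.
  rewrite (_ : series (fun k => k.+1%:R^-1 * x ^+ k.+1) = fun n => x * pseries (fun k => k.+1%:R^-1) x n).
    exact: cvgMl_tmp Cd.
  apply/funext => n; rewrite /pseries /series /= mulr_sumr.
  by apply: eq_bigr => i _; rewrite exprS /=; ring.
apply: (@pseries_snd_diffs _ c2 K) => //.
- exact: cvg_pseries_bounded c2_bound _.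
- by rewrite c2_diffs; exact: cvg_pseries_bounded d2_bound _.
- by rewrite c2_diffs; exact: cvg_pseries_bounded dd2_bound _.
Qed.

(** With x = y / (1 + y) one has 1 - x = 1 / (1 + y), so both logarithms of the derivative of
    [rogersL] become combinations of log y and log (1 + y). The constant is the $6/\pi^2$ of
    [ldilog] times the 1/2 in the derivative of [rogersL]. *)
Lemma is_derive_ldilog y : 0 < y -> is_derive y 1 (@ldilog R)
  (3 / pi ^+ 2 * (ln (1 + y) / y - ln y / (1 + y))).
Proof.
move=> y0; have y1 : 0 < 1 + y by rewrite addr_gt0.
pose x := y / (1 + y).
have x1 : 0 < x < 1 by rewrite divr_gt0 // ltr_pdivrMr // mul1r ltrDr ltr01.
have [x0 _] := andP x1.
have E1 : 1 - x = (1 + y)^-1 by rewrite /x; field; rewrite lt0r_neq0.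
have x1' : 0 < 1 - x by rewrite E1 invr_gt0.
have dL : is_derive x 1 (@rogersL R) (- 2^-1 * (ln (1 - x) / x + ln x / (1 - x))).
  have h1 := is_derive_Li2 x1.
  have h2 := is_derive1_ln x0.
  have h3 := is_derive1_ln x1'.
  rewrite /rogersL; apply: is_derive1_eq; rewrite /GRing.scale /=.
  by field; rewrite !lt0r_neq0.
have dV : is_derive y 1 (fun z : R => (1 + z)^-1) (- (1 + y) ^- 2).
  apply: is_derive1_eq; first by apply: is_deriveV; rewrite lt0r_neq0.
  by rewrite add0r /GRing.scale /= mulr1.
have dx : is_derive y 1 (fun z : R => z / (1 + z)) ((1 + y) ^- 2).
  by apply: is_derive1_eq; rewrite /GRing.scale /=; field; rewrite lt0r_neq0.
rewrite /ldilog; apply: is_derive1_eq; rewrite /GRing.scale /= E1 ln_div // lnV ?posrE //.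
have p0 : pi != 0 :> R by rewrite lt0r_neq0 // pi_gt0.
by rewrite /x; move: (pi : R) p0 => p p0; field; rewrite p0 !lt0r_neq0.
Qed.

Lemma ldilogV y : 0 < y -> ldilog y^-1 + ldilog y = ldilog 1 + ldilog 1.
Proof.
pose f z : R := ldilog z^-1 + ldilog z.
have fd (z : R) : 0 < z -> is_derive z 1 f 0.
  move=> z0; have z0' : 0 < z^-1 by rewrite invr_gt0.
  have h1 := is_derive_ldilog z0.
  have h2 := is_derive_ldilog z0'.
  have h3 : is_derive z 1 (fun z : R => z^-1) (- z ^- 2).
    apply: is_derive1_eq; first by apply: is_deriveV; rewrite lt0r_neq0.
    by rewrite /GRing.scale /= mulr1.
  apply: is_derive1_eq; rewrite /GRing.scale /= lnV ?posrE //.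
  have z1 : 0 < 1 + z by rewrite addr_gt0.
  have -> : ln (1 + z^-1) = ln (1 + z) - ln z.
    by rewrite -ln_div //; congr ln; field; rewrite lt0r_neq0.
  have p0 : pi != 0 :> R by rewrite lt0r_neq0 // pi_gt0.
  by move: (pi : R) p0 => p p0; field; rewrite p0 !lt0r_neq0.
move=> y0; have -> : ldilog 1 + ldilog 1 = f 1 by rewrite /f invr1.
rewrite -[LHS]/(f y).
have [y1|y1] := leP y 1.
  apply: eq_of_derive0 y1 _ => z; rewrite in_itv /= => /andP[yz _].
  exact/fd/(lt_le_trans y0).
apply/esym/(eq_of_derive0 (ltW y1)) => z; rewrite in_itv /= => /andP[yz _].
exact/fd/(lt_le_trans ltr01).
Qed.

End Dilog.

(** * Minors with rows and columns given by lists *)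

Section Minors.
Variable R : comNzRingType.
Implicit Types (F G m : nat -> nat -> R) (s t K : seq nat).

(** The entries are given at all pairs of naturals and the size is a mere parameter, so block
    decompositions and expansions can change the size freely. *)
Definition dt k F : R := \det (\matrix_(i < k, j < k) F i j).

Lemma eq_dt k F G :
  (forall i j, (i < k)%N -> (j < k)%N -> F i j = G i j) -> dt k F = dt k G.
Proof. by move=> FG; congr (\det _); apply/matrixP => i j; rewrite !mxE FG. Qed.

Lemma dt_tr k F : dt k F = dt k (fun i j => F j i).
Proof. by rewrite /dt -det_tr; congr (\det _); apply/matrixP => i j; rewrite !mxE. Qed.

Lemma dt_row p k F : (p <= k)%N ->
  dt k.+1 F = \sum_(j < k.+1) F p j * ((-1) ^+ (p + j)
     * dt k (fun i l => F (bump p i) (bump j l))).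
Proof.
move=> pk; rewrite /dt (expand_det_row _ (inord p)).
apply: eq_bigr => j _; rewrite /cofactor !mxE inordK //; congr (_ * (_ * \det _)).
by apply/matrixP => i l; rewrite !mxE /= inordK.
Qed.

Lemma dt_col0 k F :
  dt k.+1 F = \sum_(i < k.+1) F i 0%N * ((-1) ^+ i
     * dt k (fun j l => F (bump i j) l.+1)).
Proof.
rewrite dt_tr (@dt_row 0) //; apply: eq_bigr => i _.
by rewrite add0n [in RHS]dt_tr.
Qed.

Lemma dt_eq_rows k F p q : (p < q)%N -> (q < k)%N ->
  (forall j, (j < k)%N -> F p j = F q j) -> dt k F = 0.
Proof.
move=> pq qk Fpq; have pk : (p < k)%N by apply: ltn_trans qk.
rewrite /dt (@determinant_alternate _ _ _ (Ordinal pk) (Ordinal qk)) //.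
  by apply/eqP => /(congr1 val)/= /eqP; rewrite ltn_eqF.
by move=> j; rewrite !mxE Fpq.
Qed.

Lemma dt_ublock p q F : (forall i j, (p <= i < p + q)%N -> (j < p)%N -> F i j = 0) ->
  dt (p + q) F = dt p F * dt q (fun i j => F (p + i)%N (p + j)%N).
Proof.
move=> F0; rewrite /dt -(@det_ublock _ _ _ _ (\matrix_(i, j) F i (p + j)%N)).
congr (\det _); apply/matrixP => i j.
case: (split_ordP i) => i' ->; case: (split_ordP j) => j' ->.
- by rewrite block_mxEul !mxE.
- by rewrite block_mxEur !mxE.
- by rewrite block_mxEdl !mxE F0 //= leq_addr ltn_add2l /=.
- by rewrite block_mxEdr !mxE.
Qed.

(** The zero block has k - p rows and p + 1 columns, which is one too many: after splitting off the
    first p + 1 rows and columns, the last row of that diagonal block is zero. *)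
Lemma dt_zero_block k F p : (p < k)%N ->
  (forall i j, (p <= i < k)%N -> (j <= p)%N -> F i j = 0) -> dt k F = 0.
Proof.
move=> pk F0; rewrite -(subnKC pk) dt_ublock; last first.
  by move=> i j; rewrite subnKC // => /andP[pi ik] jp; rewrite F0 ?(ltnW pi).
rewrite [dt p.+1 F](@dt_row p) // big1 ?mul0r // => j _.
by rewrite F0 ?mul0r ?leqnn ?pk // -ltnS.
Qed.

Lemma dt0 F : dt 0 F = 1.
Proof. exact: det_mx00. Qed.

Lemma dt_trig k F : (forall i j, (i < j)%N -> (j < k)%N -> F i j = 0) ->
  dt k F = \prod_(i < k) F i i.
Proof.
move=> F0; rewrite /dt det_trig; first by apply: eq_bigr => i _; rewrite mxE.
by apply/is_trig_mxP => i j ij; rewrite mxE F0.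
Qed.

(** The lists may be unordered and have repetitions, so [mn] is an alternating form in the rows; the
    Plucker relations are proved in this generality. *)
Definition mn m s t : R := dt (size s) (fun i j => m (nth 0%N s i) (nth 0%N t j)).

Lemma mn_tr m s t : size s = size t -> mn m s t = mn (fun i j => m j i) t s.
Proof. by move=> st; rewrite /mn dt_tr st. Qed.

Lemma nth_bump_cat K1 K2 a i :
  nth 0%N (K1 ++ a :: K2) (bump (size K1) i) = nth 0%N (K1 ++ K2) i.
Proof.
rewrite !nth_cat /bump; have [k1i|ik1] := leqP (size K1) i.
  by rewrite add1n ltnNge (leqW k1i) /= subSn.
by rewrite add0n ik1.
Qed.

Lemma mn_move m K1 K2 a t :
  mn m (K1 ++ a :: K2) t = (-1) ^+ size K1 * mn m (a :: K1 ++ K2) t.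
Proof.
rewrite /mn /= !size_cat /= addnS (@dt_row (size K1)) ?leq_addr //.
rewrite (@dt_row 0) // mulr_sumr; apply: eq_bigr => j _ /=.
rewrite ?add0n nth_cat ltnn subnn /= exprD.
rewrite (mulrCA _ (m _ _)) -!mulrA; congr (_ * (_ * (_ * _))).
by apply: eq_dt => i l _ _; rewrite nth_bump_cat.
Qed.

Lemma mn_row_mem m a K t : a \in K -> mn m (a :: K) t = 0.
Proof.
move=> aK; apply: (@dt_eq_rows _ _ 0 (index a K).+1) => //=.
  by rewrite ltnS index_mem.
by move=> j _; rewrite nth_index.
Qed.

(** The cofactors of a row placed in front of [K]. They do not involve that row, which makes
    [mn_cons] an expression linear in it. *)
Definition cf m K t (j : nat) : R := (-1) ^+ j *
  dt (size K) (fun i l => m (nth 0%N K i) (nth 0%N t (bump j l))).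

Lemma mn_cons m a K t :
  mn m (a :: K) t = \sum_(j < (size K).+1) m a (nth 0%N t j) * cf m K t j.
Proof. by rewrite /mn /= (@dt_row 0). Qed.

(* The determinant with rows r and columns y, t vanishes when y is in t;
   expanding it along the column y gives a linear relation between the rows of
   r, to which the alternating form mn m (_ :: K) t' is then applied. *)
Lemma plucker_sum m r K t t' :
  size t = (size r).-1 -> size t' = (size K).+1 -> {subset t' <= t} ->
  \sum_(i < size r) (-1) ^+ i * mn m (take i r ++ drop i.+1 r) t
     * mn m (nth 0%N r i :: K) t' = 0.
Proof.
case: r => [|r0 r]; first by rewrite big_ord0.
set r1 := r0 :: r; move=> /= st st' t't.
under eq_bigr => i _ do rewrite mn_cons mulr_sumr.
rewrite exchange_big big1 //= => j _.
have : mn m r1 (nth 0%N t' j :: t) = 0.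
  rewrite mn_tr /= ?st // mn_row_mem //; apply: t't.
  by rewrite mem_nth // st'.
rewrite /mn /= dt_col0 /= => /(congr1 ( *%R^~ (cf m K t' j))); rewrite mul0r => E.
rewrite -[RHS]E mulr_suml; apply: eq_bigr => i _.
have sz : size (take i r1 ++ drop i.+1 r1) = size r.
  by rewrite size_cat size_take size_drop /= ltn_ord; have := ltn_ord i; lia.
rewrite sz [X in _ * X * _](_ : _ =
  dt (size r) (fun j0 l => m (nth 0%N r1 (bump i j0)) (nth 0%N t l))); last first.
  apply: eq_dt => a l _ _; congr (m _ _).
  have := nth_bump_cat (take i r1) (drop i.+1 r1) (nth 0%N r1 i) a.
  rewrite -drop_nth ?cat_take_drop ?ltn_ord // => <-.
  by rewrite size_takel // ltnW ?ltn_ord.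
by ring.
Qed.

(** Apply [plucker_sum] to the rows a, b, c, K: the terms that single out a row of [K] repeat it in
    the second minor and vanish, so three terms remain. *)
Lemma plucker_front m a b c K t t' :
  size t = (size K).+2 -> size t' = (size K).+1 -> {subset t' <= t} ->
  mn m (a :: K) t' * mn m (b :: c :: K) t + mn m (a :: b :: K) t * mn m (c :: K) t'
  = mn m (a :: c :: K) t * mn m (b :: K) t'.
Proof.
move=> st st' t't.
have := @plucker_sum m [:: a, b, c & K] K t t' st st' t't.
rewrite /= !big_ord_recl big1 => [/=|i _ /=]; last first.
  by rewrite /bump /= [X in _ * X]mn_row_mem ?mulr0 // add0n mem_nth.
rewrite drop0 /bump /= => E.
apply/eqP; rewrite -subr_eq0 -[X in _ == X]E; apply/eqP; ring.
Qed.

(** Moving a, b and c to the front costs signs, but all three products get the same one,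
    $(-1)^{|K_1|+|K_3|}$, because [K2] is crossed an even number of times or not at all. So the
    relation keeps its form for rows in increasing order. *)
Lemma mn_sorted3 m t t' K1 K2 K3 K4 a b c (K := K1 ++ K2 ++ K3 ++ K4) :
  exists2 e : R, e * e = 1 &
  [/\ mn m (K1 ++ a :: K2 ++ K3 ++ K4) t' * mn m (K1 ++ K2 ++ b :: K3 ++ c :: K4) t
      = e * (mn m (a :: K) t' * mn m (b :: c :: K) t),
      mn m (K1 ++ a :: K2 ++ b :: K3 ++ K4) t * mn m (K1 ++ K2 ++ K3 ++ c :: K4) t'
      = e * (mn m (a :: b :: K) t * mn m (c :: K) t') &
      mn m (K1 ++ a :: K2 ++ K3 ++ c :: K4) t * mn m (K1 ++ K2 ++ b :: K3 ++ K4) t'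
      = e * (mn m (a :: c :: K) t * mn m (b :: K) t')].
Proof.
have mv1 L x L' u : mn m (L ++ x :: L') u = (-1) ^+ size L * mn m (x :: L ++ L') u.
  exact: mn_move.
have mv2 x L y L' u : mn m (x :: L ++ y :: L') u
    = (-1) ^+ (size L).+1 * mn m (y :: x :: L ++ L') u.
  exact: (mv1 (x :: L)).
have sw x y L u : mn m (x :: y :: L) u = - mn m (y :: x :: L) u.
  by rewrite -[x :: _]/(x :: [::] ++ y :: L) (mv2 x [::] y) expr1 mulN1r.
have e1 k : (-1 : R) ^+ k * (-1) ^+ k = 1 by rewrite -exprMn mulrN1 opprK expr1n.
pose x1 : R := (-1) ^+ size K1; pose x2 : R := (-1) ^+ size K2.
pose x3 : R := (-1) ^+ size K3.
have xx1 : x1 * x1 = 1 by exact: e1.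
have xx2 : x2 * x2 = 1 by exact: e1.
have xx3 : x3 * x3 = 1 by exact: e1.
have Ea : mn m (K1 ++ a :: K2 ++ K3 ++ K4) t' = x1 * mn m (a :: K) t' by exact: mv1.
have Eb : mn m (K1 ++ K2 ++ b :: K3 ++ K4) t' = x1 * x2 * mn m (b :: K) t'.
  by rewrite catA mv1 -!catA size_cat exprD.
have Ec : mn m (K1 ++ K2 ++ K3 ++ c :: K4) t' = x1 * x2 * x3 * mn m (c :: K) t'.
  by rewrite !catA mv1 -!catA !size_cat !exprD /K /x1 /x2 /x3 !mulrA.
have Eab : mn m (K1 ++ a :: K2 ++ b :: K3 ++ K4) t = x2 * mn m (a :: b :: K) t.
  rewrite mv1 (catA K1) mv2 -!catA size_cat exprS exprD sw -/K -/x1 -/x2.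
  by transitivity ((x1 * x1) * x2 * mn m [:: a, b & K] t); [ring | rewrite xx1 mul1r].
have Ebc : mn m (K1 ++ K2 ++ b :: K3 ++ c :: K4) t = x3 * mn m (b :: c :: K) t.
  rewrite catA mv1 (catA _ K3) mv2 -!catA !size_cat exprS !exprD sw -/K -/x1 -/x2 -/x3.
  transitivity ((x1 * x1) * (x2 * x2) * x3 * mn m [:: b, c & K] t); first by ring.
  by rewrite xx1 xx2 !mul1r.
have Eac : mn m (K1 ++ a :: K2 ++ K3 ++ c :: K4) t = x2 * x3 * mn m (a :: c :: K) t.
  rewrite mv1 (catA K2) (catA K1) mv2 -!catA !size_cat exprS !exprD sw -/K -/x1 -/x2 -/x3.
  by transitivity ((x1 * x1) * (x2 * x3) * mn m [:: a, c & K] t); [ring | rewrite xx1 mul1r].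
exists (x1 * x3); first by rewrite mulrACA xx1 xx3 mulr1.
rewrite Ea Eb Ec Eab Ebc Eac; split; first by ring.
  transitivity ((x2 * x2) * (x1 * x3) * (mn m [:: a, b & K] t * mn m (c :: K) t')).
    by ring.
  by rewrite xx2 mul1r.
transitivity ((x2 * x2) * (x1 * x3) * (mn m [:: a, c & K] t * mn m (b :: K) t')).
  by ring.
by rewrite xx2 mul1r.
Qed.

Lemma plucker m t t' K1 K2 K3 K4 a b c :
  size t = (size (K1 ++ K2 ++ K3 ++ K4)).+2 ->
  size t' = (size (K1 ++ K2 ++ K3 ++ K4)).+1 -> {subset t' <= t} ->
  mn m (K1 ++ a :: K2 ++ K3 ++ K4) t' * mn m (K1 ++ K2 ++ b :: K3 ++ c :: K4) t
  + mn m (K1 ++ a :: K2 ++ b :: K3 ++ K4) t * mn m (K1 ++ K2 ++ K3 ++ c :: K4) t'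
  = mn m (K1 ++ a :: K2 ++ K3 ++ c :: K4) t * mn m (K1 ++ K2 ++ b :: K3 ++ K4) t'.
Proof.
move=> st st' t't; have [e _ [-> -> ->]] := mn_sorted3 m t t' K1 K2 K3 K4 a b c.
by rewrite -mulrDr plucker_front.
Qed.
End Minors.

(** * Total positivity *)

Section Lists.
Implicit Types (s t K : seq nat).

Lemma all2_leq_cat s1 s2 t1 t2 : all2 leq s1 t1 -> all2 leq s2 t2 ->
  all2 leq (s1 ++ s2) (t1 ++ t2).
Proof. by elim: s1 t1 => [|x s1 IH] [|y t1] //= /andP[-> /IH h] /h. Qed.

Lemma all2_leq_rcons s t x y :
  all2 leq (rcons s x) (rcons t y) = all2 leq s t && (x <= y)%N.
Proof.
elim: s t => [|a s IH] [|b t] //=; rewrite ?andbT // ?IH ?andbA //.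
  by case: t => [|? ?]; rewrite /= !andbF.
by case: s {IH} => [|? ?]; rewrite /= !andbF.
Qed.

Lemma all2_leq_refl s : all2 leq s s.
Proof. by elim: s => //= x s ->; rewrite leqnn. Qed.

Lemma all2_leq_trans s t u : all2 leq s t -> all2 leq t u -> all2 leq s u.
Proof.
elim: s t u => [|x s IH] [|y t] [|z u] //= /andP[xy st] /andP[yz tu].
by rewrite (leq_trans xy yz) (IH t).
Qed.

Lemma all2_leq_shift x s y : sorted ltn (x :: rcons s y) ->
  all2 leq (x :: s) (rcons s y).
Proof.
elim: s x => [|z s IH] x /=; first by rewrite !andbT => /ltnW.
by case/andP => xz h; apply/andP; split; [exact: ltnW | exact: IH].
Qed.

Lemma all2_leq_size s t : all2 leq s t -> size s = size t.
Proof. by elim: s t => [|x s IH] [|y t] //= /andP[_ /IH ->]. Qed.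

Lemma all2_leqPn s t : size s = size t -> ~~ all2 leq s t ->
  exists2 i, (i < size s)%N & (nth 0%N t i < nth 0%N s i)%N.
Proof.
elim: s t => [|x s IH] [|y t] //= [st]; rewrite negb_and => /orP[|/(IH _ st)].
  by rewrite -ltnNge; exists 0%N.
by case=> i ? ?; exists i.+1.
Qed.

Lemma sorted_nth s i j : sorted ltn s -> (j < size s)%N -> (i < j)%N ->
  (nth 0%N s i < nth 0%N s j)%N.
Proof.
move=> ss js ij; apply: (sorted_ltn_nth ltn_trans) => //; rewrite inE //.
exact: ltn_trans js.
Qed.

Lemma sorted_nth_leq s i j : sorted ltn s -> (j < size s)%N -> (i <= j)%N ->
  (nth 0%N s i <= nth 0%N s j)%N.
Proof.
by move=> ss js; rewrite leq_eqVlt => /predU1P[->//|ij]; exact/ltnW/sorted_nth.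
Qed.

Lemma sorted_gap s : sorted ltn s -> s = iota (head 0%N s) (size s) \/
  exists K x y K', s = K ++ x :: y :: K' /\ (x.+1 < y)%N.
Proof.
elim: s => [|x [|y s] IH] //= ; [by left|by left|].
case/andP=> xy ps; case: (ltngtP x.+1 y) => [xy1|yx|xy1].
- by right; exists [::], x, y, s.
- by lia.
case: (IH ps) => [/= E|[K [u [v [K' [E uv]]]]]].
  by left; rewrite xy1; congr (_ :: _).
by right; exists (x :: K), u, v, K'; rewrite E.
Qed.

Lemma all2_leq_nth s t i : all2 leq s t -> (nth 0%N s i <= nth 0%N t i)%N.
Proof.
by elim: s t i => [|x s IH] [|y t] [|i] //= /andP[xy st] //; exact: IH.
Qed.

Lemma all2_leq_gtn b s t : all2 leq s t -> all (gtn b) t -> all (gtn b) s.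
Proof.
elim: s t => [|x s IH] [|y t] //= /andP[xy st] /andP[yb tb].
by rewrite (leq_ltn_trans xy) // (IH t).
Qed.

Lemma sorted_cat_iota s a k : sorted ltn s -> all (gtn a) s ->
  sorted ltn (s ++ iota a k).
Proof.
move=> ss /allP sa; rewrite (sorted_pairwise ltn_trans) pairwise_cat.
rewrite -!(sorted_pairwise ltn_trans) ss iota_ltn_sorted !andbT.
apply/allrelP => x y /sa /= xa; rewrite mem_iota => /andP[ay _].
exact: leq_trans ay.
Qed.

Lemma sorted_insert K x z y K' : (x < z)%N -> (z < y)%N ->
  sorted ltn (K ++ x :: y :: K') -> sorted ltn (K ++ x :: z :: y :: K').
Proof.
move=> xz zy; case: K => [|k K] /=; first by rewrite xz zy => /andP[].
by rewrite !cat_path /= xz zy => /and4P[-> -> _ ->].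
Qed.

End Lists.

Section TotalPositivity.
Variable R : realFieldType.
Variable n : nat.
Implicit Types (m : nat -> nat -> R) (s t K : seq nat).

Definition slist s := sorted ltn s && all (gtn n) s.
Definition upper m := forall i j, (j < i)%N -> (i < n)%N -> m i j = 0.
Definition unitri m := upper m /\ forall i, (i < n)%N -> m i i = 1.
(** For increasing lists, [all2 leq s t] (which forces equal sizes) says exactly that the minor does
    not vanish identically on upper triangular matrices: see [mn_vanish] and
    [minor_not_identically_0]. *)
Definition tp m := forall s t, slist s -> slist t -> all2 leq s t -> 0 < mn m s t.
Definition DL m s := mn m s (iota (n - size s) (size s)).

(** If position p violates the order, the rows from p on and the columns up to p lie below the
    diagonal and form the oversized zero block of [dt_zero_block]. *)
Lemma mn_vanish m s t : upper m -> slist s -> sorted ltn t ->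
  size s = size t -> ~~ all2 leq s t -> mn m s t = 0.
Proof.
move=> um /andP[ss /allP sn] st sz /(all2_leqPn sz)[p ps pst].
apply: (@dt_zero_block _ _ _ p) => // i j /andP[pi iS] jp.
apply: um; last by apply: sn; exact: mem_nth.
rewrite (leq_ltn_trans (sorted_nth_leq st _ jp)) -?sz //.
exact: leq_trans (sorted_nth_leq ss iS pi).
Qed.

Lemma mn_diag m s : unitri m -> slist s -> mn m s s = 1.
Proof.
move=> [um m1] /andP[ss /allP sn]; rewrite /mn dt_tr dt_trig => [|i j ij js].
  by rewrite big1 // => i _; rewrite m1 //; apply: sn; exact: mem_nth.
by rewrite um ?sorted_nth //; apply: sn; exact: mem_nth.
Qed.

Lemma mn_cat m s1 s2 t1 t2 : size s1 = size t1 ->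
  (forall i j, i \in s2 -> j \in t1 -> m i j = 0) ->
  mn m (s1 ++ s2) (t1 ++ t2) = mn m s1 t1 * mn m s2 t2.
Proof.
move=> sz m0; rewrite /mn size_cat dt_ublock => [|i j /andP[i1 i2] j1].
  congr (_ * _); apply: eq_dt => i j i1 j1; rewrite !nth_cat -?sz ?i1 ?j1 //.
  by rewrite !ltnNge !leq_addr /= !addKn.
rewrite !nth_cat -sz j1 ltnNge i1 /=; apply: m0; apply: mem_nth; rewrite -?sz //.
by rewrite ltn_subLR.
Qed.

Lemma mn_ge0 m s t : upper m -> tp m -> slist s -> slist t -> size s = size t ->
  0 <= mn m s t.
Proof.
move=> um tpm ss st sz; have [st2|st2] := boolP (all2 leq s t).
  exact/ltW/tpm.
by rewrite mn_vanish //; case/andP: st.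
Qed.

Lemma slist_iota a k : (a + k <= n)%N -> slist (iota a k).
Proof.
move=> akn; rewrite /slist iota_ltn_sorted; apply/allP => i.
by rewrite mem_iota /= => /andP[_ h]; apply: leq_trans akn.
Qed.

Lemma slist_sub s s' : subseq s' s -> slist s -> slist s'.
Proof.
move=> ss' /andP[so sn]; rewrite /slist (subseq_sorted ltn_trans ss') //.
by apply/allP => i /(mem_subseq ss') /(allP sn).
Qed.

(* Induction on the size of the minor, then on the spread of its columns. A minor
   with consecutive columns is a flag minor, completed by an identity block;
   otherwise a Plucker relation inserts a column in a gap. *)
Lemma cryer m : unitri m -> (forall s, slist s -> 0 < DL m s) -> tp m.
Proof.
move=> um DLm.
suff H k d s t : (size t <= k)%N -> (last 0%N t - head 0%N t < d)%N ->
    slist s -> slist t -> all2 leq s t -> 0 < mn m s t.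
  by move=> s t; exact: (H _ _ s t (leqnn _) (ltnSn _)).
elim: k d s t => [|k IHk] d s t.
  rewrite leqn0 size_eq0 => /eqP -> _ _ _ /all2_leq_size /= /size0nil ->.
  by rewrite /mn dt0 ltr01.
elim: d s t => [//|d IHd] s t stk tgap ss st st2.
have sz := all2_leq_size st2.
have /andP[sos sns] := ss; have /andP[sot snt] := st.
case: (sorted_gap sot) => [E|[K [x [y [K' [E xy]]]]]].
  case: (posnP (size t)) => [/size0nil t0|t_gt0].
    by move: sz; rewrite t0 => /size0nil ->; rewrite /mn dt0 ltr01.
  set h := head 0%N t in E; set l := size t in E t_gt0.
  have hln : (h + l <= n)%N.
    move/allP: snt => /(_ (h + l.-1)%N); rewrite E mem_iota /= => H.
    by rewrite -(prednK t_gt0) addnS H //; lia.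
  have st' : all (gtn (h + l)) s.
    by apply: all2_leq_gtn st2 _; rewrite E; apply/allP => i; rewrite mem_iota => /andP[].
  have sl' : slist (s ++ iota (h + l) (n - (h + l))).
    rewrite /slist sorted_cat_iota // all_cat sns; apply/allP => i.
    by rewrite mem_iota subnKC // => /andP[].
  have := DLm _ sl'; rewrite /DL size_cat size_iota sz -/l.
  have -> : (n - (l + (n - (h + l))) = h)%N by move: hln; clear; lia.
  rewrite iotaD -E mn_cat //; last first.
    move=> i j; rewrite mem_iota subnKC // => /andP[hi i_n]; rewrite E mem_iota => /andP[_ jh].
    by apply: um.1 => //; apply: leq_trans hi.
  by rewrite mn_diag ?mulr1 //; apply: slist_iota; rewrite subnKC.
have [j1 [K2 EK]] : exists j1 K2, rcons K x = j1 :: K2.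
  by case: (K) => [|k0 K0]; [exists x, [::] | exists k0, (rcons K0 x)].
have [K3 [jk EK']] : exists K3 jk, y :: K' = rcons K3 jk.
  by case/lastP: (K') => [|K0 k0]; [exists [::], y | exists (y :: K0), k0].
(* [j'] lies in a gap of [t]; replacing the first column [j1] or the last one [jk] by it shortens
   the spread. With [s0] the rows without the last one and [u; v] for minors, the relation to be
   used is [s0; t - jk] [s; p + jk] + [s; j1 + p] [s0; t - j1] = [s; t] [s0; p]. By induction the
   first product and [s0; p] are positive and the second product is nonnegative. *)
pose j' := x.+1; pose p := K2 ++ j' :: K3.
have Et : t = j1 :: K2 ++ K3 ++ [:: jk] by rewrite E -(cat_rcons x K) EK EK' -cats1.
have slist_e : slist (j1 :: p ++ [:: jk]).
  have -> : j1 :: p ++ [:: jk] = K ++ x :: j' :: y :: K'.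
    by rewrite -(cat_rcons x K) EK EK' -cats1 /p -catA.
  rewrite /slist sorted_insert -?E //=.
  move: snt; rewrite E !all_cat /= => /and4P[-> -> yn ->]; rewrite yn /=.
  by rewrite (ltn_trans xy).
have /andP[se _] := slist_e.
have lt_jk : (last j1 p < jk)%N.
  by move: se; rewrite /= cat_path /= andbT => /andP[].
have lt_j1 : (j1 < head 0%N (p ++ [:: jk]))%N.
  by move: se; rewrite /=; case: (p) => [|p0 p'] /= /andP[].
have j1jk : (j1 < jk)%N.
  have /= := order_path_min ltn_trans se; rewrite all_cat /= andbT.
  by case/andP.
have gap : (jk - j1 < d.+1)%N by move: tgap; rewrite Et /= !last_cat.
have sl1 : slist (j1 :: p) by apply: slist_sub slist_e; rewrite -cat_cons prefix_subseq.
have sl2 : slist (p ++ [:: jk]) by apply: slist_sub slist_e; exact: subseq_cons.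
have slp : slist p by apply: slist_sub sl1; exact: subseq_cons.
have slK : slist (j1 :: K2 ++ K3).
  apply: slist_sub sl1; rewrite -!cat_cons cat_subseq //; exact: subseq_cons.
have slK' : slist (K2 ++ K3 ++ [:: jk]).
  by apply: slist_sub sl2; rewrite -catA cat_subseq //; exact: subseq_cons.
have shift : all2 leq (j1 :: K2) (rcons K2 j').
  apply: all2_leq_shift; case/andP: sl1; rewrite /p -cat_rcons -cat_cons.
  by move=> /(subseq_sorted ltn_trans (prefix_subseq _ _)).
have [s0 [il Es]] : exists s0 il, s = rcons s0 il.
  by case/lastP: (s) sz => [|s0 il]; [rewrite Et | exists s0, il].
have st0 : all2 leq s0 (j1 :: K2 ++ K3).
  move: st2; rewrite Es Et !catA cats1 -rcons_cons all2_leq_rcons.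
  by case/andP.
have ss0 : slist s0.
  by apply: slist_sub ss; rewrite Es subseq_rcons.
have up' := um.1.
have tpk u v : slist u -> slist v -> all2 leq u v -> (size v <= k)%N -> 0 < mn m u v.
  by move=> su sv uv vk; exact: (IHk _ u v vk (ltnSn _)).
have ge0k u v : slist u -> slist v -> size u = size v -> (size v <= k)%N -> 0 <= mn m u v.
  move=> su sv uv vk; have [uv2|uv2] := boolP (all2 leq u v); first exact/ltW/tpk.
  by rewrite mn_vanish //; case/andP: sv.
have sz0 : size s0 = (size (K2 ++ K3)).+1 by rewrite (all2_leq_size st0).
have szs : size s = (size (K2 ++ K3)).+2 by rewrite Es size_rcons sz0.
have szt1 : size (j1 :: p) = size s by rewrite szs /p /= !size_cat /= addnS.
have szt2 : size (p ++ [:: jk]) = size s by rewrite -szt1 size_cat /= addn1.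
have szp : size p = size s0 by rewrite sz0 /p !size_cat /= addnS.
have szK : size (j1 :: K2 ++ K3) = size s0 by rewrite sz0.
have szK' : size (K2 ++ K3 ++ [:: jk]) = size s0.
  by rewrite sz0 !size_cat /= addn1 addnS.
have s0k : (size s0 <= k)%N.
  by rewrite -ltnS; apply: leq_trans stk; rewrite -sz szs sz0.
have stp : all2 leq s0 p.
  by apply: all2_leq_trans st0 _; rewrite -cat_cons /p -cat_rcons all2_leq_cat ?all2_leq_refl.
have s_t2 : all2 leq s (p ++ [:: jk]).
  apply: all2_leq_trans st2 _; rewrite Et -cat_cons /p -(cat_rcons j') -catA.
  by rewrite all2_leq_cat ?all2_leq_refl.
have pos_t2 : 0 < mn m s (p ++ [:: jk]).
  apply: IHd => //; first by rewrite szt2 sz.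
  rewrite last_cat -[last _ [:: jk]]/jk; move: gap lt_j1 j1jk.
  by move: (head _ _) => h; clear; lia.
(* Lowering the columns may break [s <= j1 :: p], in which case this minor is 0; strict positivity
   comes from the other product. *)
have ge0_t1 : 0 <= mn m s (j1 :: p).
  have [st1|st1] := boolP (all2 leq s (j1 :: p)); last first.
    by rewrite mn_vanish //; case/andP: sl1.
  apply/ltW/IHd => //; first by rewrite szt1 sz.
  rewrite -[last _ _]/(last j1 p) -[head _ _]/j1; move: gap lt_jk j1jk.
  by move: (last _ _) => h; clear; lia.
(* The relation is needed between columns, whereas [plucker] exchanges rows. *)
pose m' i j := m j i.
have sub : {subset s0 <= s} by move=> i is0; rewrite Es mem_rcons inE is0 orbT.
have tr u v : size v = size u -> mn m' v u = mn m u v by move=> uv; rewrite [RHS]mn_tr.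
have := @plucker _ m' s s0 [::] K2 K3 [::] j1 j' jk.
rewrite !cat0s !cats0 => /(_ szs sz0 sub); rewrite -[K2 ++ j' :: K3]/p -[K2 ++ _ :: _ ++ _]/(K2 ++ (j' :: K3) ++ _).
rewrite (catA K2 (j' :: K3)) -/p -Et.
rewrite (tr s0 (j1 :: _)) // (tr s (p ++ _)) // (tr s (j1 :: p)) // (tr s0 (K2 ++ _)) //.
rewrite (tr s t) // (tr s0 p) // => PL.
suff : 0 < mn m s t * mn m s0 p by rewrite pmulr_lgt0 // tpk ?szp.
have posKa : 0 < mn m s0 (j1 :: K2 ++ K3) by rewrite tpk ?szK.
have posKc : 0 <= mn m s0 (K2 ++ K3 ++ [:: jk]) by rewrite ge0k ?szK'.
by rewrite -PL (lt_le_trans (mulr_gt0 posKa pos_t2)) // lerDl mulr_ge0.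
Qed.
End TotalPositivity.

(** * Reversal of index lists and reflection in the antidiagonal *)

Section Reversal.
Variable R : comNzRingType.
Implicit Types (m : nat -> nat -> R) (s t : seq nat).

(** The sign of the reversal of k rows, left as the determinant of the reversal matrix; what matters
    is that its square is 1. *)
Definition sgrev k : R := dt k (fun i j => (j == k.-1 - i)%N%:R).

Lemma mn_rev m s t : mn m (rev s) t = sgrev (size s) * mn m s t.
Proof.
rewrite /mn /sgrev /dt size_rev -det_mulmx; congr (\det _); apply/matrixP => i j.
rewrite !mxE.
have ri : ((size s).-1 - i < size s)%N by have := ltn_ord i; lia.
rewrite (bigD1 (Ordinal ri)) //= !mxE eqxx mul1r big1 ?addr0 => [|l /negPf li].
  by rewrite nth_rev // subnS predn_sub.
rewrite !mxE (_ : (_ == _) = false) ?mul0r //.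
Qed.

Lemma sgrev_sqr k : sgrev k * sgrev k = 1.
Proof.
pose m (i j : nat) : R := (i == j)%:R.
have := mn_rev m (rev (iota 0 k)) (iota 0 k).
rewrite revK mn_rev mulrA size_rev size_iota => H.
have E : mn m (iota 0 k) (iota 0 k) = 1.
  rewrite /mn size_iota dt_trig => [|i j ij jk].
    by rewrite big1 // => i _; rewrite /m eqxx.
  by rewrite /m !nth_iota ?(ltn_trans ij) // eqn_add2l ltn_eqF.
by move: H; rewrite E mulr1.
Qed.

Lemma mn_rev2 m s t : size s = size t -> mn m (rev s) (rev t) = mn m s t.
Proof.
move=> st; rewrite mn_rev mn_tr ?size_rev // mn_rev -st mulrA sgrev_sqr mul1r.
by rewrite -mn_tr.
Qed.

Lemma mn_map m (f g : nat -> nat) s t : size s = size t ->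
  mn m (map f s) (map g t) = mn (fun i j => m (f i) (g j)) s t.
Proof.
move=> st; rewrite /mn size_map; apply: eq_dt => i j si sj.
by rewrite !(nth_map 0%N) -?st.
Qed.

(* Reflection in the antidiagonal. *)
Definition tau n m := fun i j => m (n.-1 - j)%N (n.-1 - i)%N.
Definition wrev n s := rev [seq n.-1 - i | i <- s]%N.

Lemma size_wrev n s : size (wrev n s) = size s.
Proof. by rewrite size_rev size_map. Qed.

Lemma mn_tau n m s t : size s = size t ->
  mn (tau n m) s t = mn m (wrev n t) (wrev n s).
Proof.
by move=> st; rewrite mn_rev2 ?size_map // mn_map // mn_tr.
Qed.

Lemma wrev_iota n a k : (a + k <= n)%N -> wrev n (iota a k) = iota (n - (a + k)) k.
Proof.
move=> akn; apply: (@eq_from_nth _ 0%N); rewrite size_wrev !size_iota // => i ik.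
rewrite nth_rev size_map size_iota // (nth_map 0%N) ?size_iota; last by lia.
rewrite !nth_iota; lia.
Qed.

Lemma wrevK n s : all (gtn n) s -> wrev n (wrev n s) = s.
Proof.
move=> /allP sn; rewrite /wrev map_rev revK -map_comp map_id_in // => i /sn /=; lia.
Qed.

Lemma slist_wrev n s : slist n s -> slist n (wrev n s).
Proof.
move=> /andP[ss sn]; rewrite /slist /wrev all_rev; apply/andP; split.
  rewrite rev_sorted; apply: (homo_sorted_in _ sn ss) => i j /=.
  by rewrite !unfold_in /=; lia.
by apply/allP => _ /mapP[i /(allP sn) /= i_n ->]; lia.
Qed.

Lemma wrev_cat n s t : wrev n (s ++ t) = wrev n t ++ wrev n s.
Proof. by rewrite /wrev map_cat rev_cat. Qed.

End Reversal.

(** * Products, dilations and reflections of totally positive matrices *)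

Section Products.
Variable R : realFieldType.
Variable n : nat.
Implicit Types (m A B : nat -> nat -> R) (s t r : seq nat).

Definition mulm A B i j : R := \sum_(l < n) A i l * B l j.

Lemma perm_mn_mul A B s t r r' : perm_eq r r' ->
  size s = size r -> size t = size r ->
  mn A s r * mn B r t = mn A s r' * mn B r' t.
Proof.
move=> rr' sr tr; have sz := perm_size rr'.
have /tuple_permP[p E] : perm_eq r' (in_tuple r) by rewrite perm_sym.
have Er' (i : 'I_(size r)) : nth 0%N r' i = nth 0%N r (p i).
  by rewrite E -(tnth_nth 0%N) tnth_mktuple (tnth_nth 0%N).
have rows (C : nat -> nat -> R) u : mn C r' u = (-1) ^+ p * mn C r u.
  rewrite /mn -sz /dt -(det_perm R p) -det_mulmx; congr (\det _).
  by rewrite -row_permE; apply/matrixP => i j; rewrite !mxE Er'.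
rewrite [mn A s r'](mn_tr _) ?sr // rows -mn_tr // rows mulrACA -expr2 sqrr_sign mul1r.
by [].
Qed.

(* A Cauchy-Binet formula over all maps instead of all subsets: every subset is
   counted once for each of its orderings, whence the factorial. *)
Lemma det_mul_sum A B s t : size s = size t ->
  (size s)`!%:R * mn (mulm A B) s t =
  \sum_(f : {ffun 'I_(size s) -> 'I_n})
     (let r := [seq val (f i) | i <- enum 'I_(size s)] in mn A s r * mn B r t).
Proof.
move=> st; set k := size s.
pose a f := \prod_(i < k) A (nth 0%N s i) (f i : 'I_n).
pose b (f : {ffun 'I_k -> 'I_n}) := \det (\matrix_(i < k, j < k) B (f i) (nth 0%N t j)).
have E1 : mn (mulm A B) s t = \sum_(f : {ffun 'I_k -> 'I_n}) a f * b f.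
  rewrite /mn -/k /dt /determinant.
  under eq_bigr => p _.
    under eq_bigr => i _ do rewrite mxE /mulm.
    rewrite bigA_distr_bigA /= mulr_sumr; over.
  rewrite exchange_big; apply: eq_bigr => f _ /=.
  rewrite mulr_sumr; apply: eq_bigr => p _.
  rewrite big_split /= mulrCA; congr (_ * (_ * _)).
  by apply: eq_bigr => i _; rewrite mxE.
have E2 (f : {ffun 'I_k -> 'I_n}) : mn A s [seq val (f i) | i <- enum 'I_k] =
    \sum_(p : 'S_k) (-1) ^+ p * a [ffun i => f (p i)].
  rewrite /mn -/k /dt /determinant; apply: eq_bigr => p _; congr (_ * _).
  apply: eq_bigr => i _; rewrite mxE ffunE (nth_map i) ?size_enum_ord //.
  by rewrite nth_ord_enum.
have E3 (f : {ffun 'I_k -> 'I_n}) : mn B [seq val (f i) | i <- enum 'I_k] t = b f.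
  rewrite /mn size_map size_enum_ord /b /dt; congr (\det _); apply/matrixP => i j.
  by rewrite !mxE (nth_map i) ?size_enum_ord // nth_ord_enum.
under [RHS]eq_bigr => f _ do rewrite /= E2 E3 mulr_suml.
rewrite exchange_big /= E1.
transitivity (\sum_(p : 'S_k) \sum_(f : {ffun 'I_k -> 'I_n}) a f * b f).
  by rewrite sumr_const -[RHS]mulr_natl -card_Sn; congr (_%:R * _).
apply: eq_bigr => p _.
(* Substituting $f\circ p^{-1}$ for f multiplies [b f] by the sign of p, which cancels the sign in
   the expansion of the minor of A. So all the k! inner sums are equal. *)
pose h (q : 'S_k) (f : {ffun 'I_k -> 'I_n}) := [ffun i => f (q i)].
have hK : cancel (h p) (h p^-1%g).
  by move=> f; apply/ffunP => i; rewrite !ffunE permKV.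
have hK' : cancel (h p^-1%g) (h p).
  by move=> f; apply/ffunP => i; rewrite !ffunE permK.
rewrite [RHS](reindex_inj (can_inj hK')); apply: eq_bigr => f _.
have -> : [ffun i => h p^-1%g f (p i)] = f by apply: hK'.
have -> : b (h p^-1%g f) = (-1) ^+ p * b f.
  rewrite /b -odd_permV -det_perm -det_mulmx -row_permE; congr (\det _).
  by apply/matrixP => i j; rewrite !mxE ffunE.
by rewrite mulrACA -expr2 sqrr_sign mul1r.
Qed.


Lemma upper_mulm A B : upper n A -> upper n B -> upper n (mulm A B).
Proof.
move=> uA uB i j ji i_n; apply: big1 => l _; have [li|il] := ltnP l i.
  by rewrite uA ?mul0r.
by rewrite uB ?mulr0 // (leq_trans ji).
Qed.

Lemma unitri_mulm A B : unitri n A -> unitri n B -> unitri n (mulm A B).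
Proof.
move=> [uA A1] [uB B1]; split=> [|i i_n]; first exact: upper_mulm.
rewrite /mulm (bigD1 (Ordinal i_n)) //= A1 // B1 // mulr1 big1 ?addr0 // => l.
rewrite -val_eqE /= neq_ltn => /orP[li|il]; first by rewrite uA ?mul0r.
by rewrite uB ?mulr0.
Qed.

(** In the Cauchy-Binet sum the term with intermediate rows [s] is 1 times a positive minor of B.
    The other terms are 0 if an index is repeated, and otherwise, after sorting, products of
    nonnegative minors. *)
Lemma tp_mulm A B : unitri n A -> unitri n B -> tp n A -> tp n B -> tp n (mulm A B).
Proof.
move=> uA uB tA tB s t sl st lst; have sz := all2_leq_size lst.
have k0 : (0 : R) < (size s)`!%:R by rewrite ltr0n fact_gt0.
rewrite -(pmulr_rgt0 _ k0) det_mul_sum //.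
have [so sn] := andP sl.
have fP (i : 'I_(size s)) : (nth 0%N s i < n)%N by apply: (allP sn); exact: mem_nth.
pose f0 := [ffun i => Ordinal (fP i)].
have Ef0 : [seq val (f0 i) | i <- enum 'I_(size s)] = s.
  apply: (@eq_from_nth _ 0%N); rewrite size_map size_enum_ord // => i si.
  by rewrite (nth_map (Ordinal si)) ?size_enum_ord // ffunE /= nth_enum_ord.
rewrite (bigD1 f0) //= Ef0 (mn_diag uA sl) mul1r.
rewrite (lt_le_trans (tB _ _ sl st lst)) // lerDl; apply: sumr_ge0 => f _.
set r := map _ _; have szr : size r = size s by rewrite size_map size_enum_ord.
have [ur|nur] := boolP (uniq r); last first.
  have [i [j [ij [jr Eij]]]] : exists i j, (i < j)%N /\ (j < size r)%N /\ nth 0%N r i = nth 0%N r j.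
    move/(uniqPn 0%N): nur => [i [j [ij jr E]]]; by exists i, j.
  rewrite [X in _ * X](_ : _ = 0) ?mulr0 //.
  by apply: (@dt_eq_rows _ _ _ i j) => // l _; rewrite Eij.
rewrite (@perm_mn_mul A B s t r (sort leq r)) ?szr -?sz //; last first.
  by rewrite perm_sym perm_sort.
have slr : slist n (sort leq r).
  rewrite /slist ltn_sorted_uniq_leq sort_uniq ur (sort_sorted leq_total) /=.
  by apply/allP => i; rewrite mem_sort => /mapP[l _ ->] /=.
have szs : size (sort leq r) = size s by rewrite size_sort.
apply: mulr_ge0; first by apply: (mn_ge0 uA.1).
by apply: (mn_ge0 uB.1); rewrite ?szs.
Qed.

(** Multiplication by a lower triangular matrix on the right combines each column only with later
    ones, so the span of the last columns is preserved. The flag minors get a factor that depends on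
    their size alone. *)
Lemma DL_mulm_lower A L s : (forall i j, (i < j)%N -> L i j = 0) -> (size s <= n)%N ->
  DL n (mulm A L) s = DL n A s * DL n L (iota (n - size s) (size s)).
Proof.
move=> lL sn; rewrite /DL /mn !size_iota /dt -det_mulmx; congr (\det _).
apply/matrixP => i j; rewrite !mxE /mulm.
have szl := ltn_ord j; rewrite nth_iota //.
rewrite -(big_mkord xpredT (fun l => A (nth 0%N s i) l * L l (n - size s + j)%N)).
rewrite (@big_cat_nat _ _ _ (n - size s)) ?leq_subr //= big1_seq ?add0r => [|l]; last first.
  by rewrite mem_index_iota => /andP[_ ln]; rewrite lL ?mulr0 // ltn_addr.
rewrite -{1}[(n - size s)%N]add0n big_addn subKn // big_mkord; apply: eq_bigr => l _.
by rewrite !mxE !nth_iota // addnC.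
Qed.

Lemma mn_scale m (x y : nat -> R) s t : size s = size t ->
  mn (fun i j => x i * m i j * y j) s t
  = (\prod_(i <- s) x i) * mn m s t * (\prod_(j <- t) y j).
Proof.
move=> st; rewrite [X in X * _ * _](big_nth 0%N) [X in _ * X](big_nth 0%N) !big_mkord -st.
pose dx := \row_(i < size s) x (nth 0%N s i).
pose dy := \row_(i < size s) y (nth 0%N t i).
have -> : \prod_(i < size s) x (nth 0%N s i) = \det (diag_mx dx).
  by rewrite det_diag; apply: eq_bigr => i _; rewrite mxE.
have -> : \prod_(i < size s) y (nth 0%N t i) = \det (diag_mx dy).
  by rewrite det_diag; apply: eq_bigr => i _; rewrite mxE.
rewrite /mn /dt -!det_mulmx; congr (\det _); apply/matrixP => i j.
by rewrite mul_mx_diag mul_diag_mx !mxE.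
Qed.

(** On and above the diagonal the truncated exponent is the true one, and below it the entries are
    0: this is conjugation by the diagonal matrix of the $z^i$. *)
Lemma tp_scale m (z : R) : 0 < z -> upper n m -> tp n m ->
  tp n (fun i j => z ^+ (j - i) * m i j).
Proof.
move=> z0 um tm s t sl st lst; have sz := all2_leq_size lst.
have [_ /allP sn] := andP sl.
rewrite [mn _ s t](_ : _ = mn (fun i j => z ^- i * m i j * z ^+ j) s t); last first.
  apply: eq_dt => i j si _; have := sn _ (mem_nth 0%N si); set a := nth _ _ _; set b := nth _ _ _ => a_n.
  have [ab|ba] := leqP a b; last by rewrite um // !(mulr0, mul0r).
  have za : z ^+ a != 0 by rewrite expf_neq0 // gt_eqF.
  have -> : z ^+ b = z ^+ a * z ^+ (b - a) by rewrite -exprD subnKC.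
  by rewrite [RHS]mulrAC mulKf.
rewrite mn_scale //; apply: mulr_gt0; first apply: mulr_gt0.
- by apply: prodr_gt0 => i _; rewrite invr_gt0 exprn_gt0.
- exact: tm.
- by apply: prodr_gt0 => i _; rewrite exprn_gt0.
Qed.

Lemma upper_scale m (z : R) : upper n m -> upper n (fun i j => z ^+ (j - i) * m i j).
Proof. by move=> um i j ij i_n; rewrite um ?mulr0. Qed.

Lemma unitri_scale m (z : R) : unitri n m -> unitri n (fun i j => z ^+ (j - i) * m i j).
Proof.
move=> [um m1]; split=> [|i i_n]; first exact: upper_scale.
by rewrite subnn mul1r m1.
Qed.

Lemma tp_tau m : tp n m -> tp n (tau n m).
Proof.
move=> tm s t ss st lst; have sz := all2_leq_size lst.
rewrite mn_tau //; apply: tm; rewrite ?slist_wrev //.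
rewrite /wrev; have [_ /allP sn] := andP ss; have [_ /allP tn] := andP st.
have : all2 leq [seq n.-1 - i | i <- t]%N [seq n.-1 - i | i <- s]%N.
  by elim: s t {ss st sz sn tn} lst => [|x s IH] [|y t] //= /andP[xy /IH ->]; rewrite leq_sub2l.
elim: (map _ t) (map _ s) => [|x u IH] [|y v] //= /andP[xy /IH uv].
by rewrite !rev_cons all2_leq_rcons uv xy.
Qed.

Lemma unitri_tau m : unitri n m -> unitri n (tau n m).
Proof.
move=> [um m1]; split=> [i j ij i_n|i i_n]; first by rewrite /tau um //; lia.
by rewrite /tau m1 //; lia.
Qed.

End Products.

(** * Sums over octahedra *)

Section Octahedra.
Variable R : comNzRingType.
Implicit Types (x y : R * R) (psi : nat -> nat -> R * R)
  (phi : nat -> nat -> nat -> R * R).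

(* For x = (log f, d log f) and y = (log g, d log g) this is the form
   log f dlog g - log g dlog f. *)
Definition br x y : R := x.1 * y.2 - y.1 * x.2.

(** [P], [Q] and [S] belong to the three pairs of opposite vertices. Expanded by bilinearity, the
    sum has one [br] for each of the twelve edges. *)
Definition oct phi a b c : R :=
  let P := phi a b c.+1 + phi a.+1 b.+1 c in
  let Q := phi a b.+1 c.+1 + phi a.+1 b c in
  let S := phi a b c + phi a.+1 b.+1 c.+1 in
  br P Q + br Q S + br S P.

(** As [br] is antisymmetric, each summand is the circulation of [br] along the triangle (a, b), (a,
    b + 1), (a + 1, b + 1). *)
Definition tri n psi : R := \sum_(a < n) \sum_(b < n)
  (br (psi a b.+1) (psi a.+1 b.+1) + br (psi a b) (psi a b.+1)
   - br (psi a b) (psi a.+1 b.+1)).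

Lemma br0l y : br 0 y = 0. Proof. by rewrite /br /= !(mul0r, mulr0) subr0. Qed.
Lemma br0r x : br x 0 = 0. Proof. by rewrite /br /= !(mul0r, mulr0) subr0. Qed.

Let sum3 n (F : nat -> nat -> nat -> R) : R :=
  \sum_(a < n) \sum_(b < n) \sum_(c < n) F a b c.

Let sum3D n F G : sum3 n (fun a b c => F a b c + G a b c) = sum3 n F + sum3 n G.
Proof.
rewrite /sum3 -big_split; apply: eq_bigr => a _.
by rewrite -big_split; apply: eq_bigr => b _; rewrite -big_split.
Qed.

Let tele n (f : nat -> R) : \sum_(i < n) (f i.+1 - f i) = f n - f 0%N.
Proof. by rewrite -(big_mkord xpredT (fun i => f i.+1 - f i)) telescope_sumr. Qed.

Let telea n F : sum3 n (fun a b c => F a.+1 b c - F a b c) =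
  \sum_(b < n) \sum_(c < n) (F n b c - F 0%N b c).
Proof.
rewrite /sum3 exchange_big; apply: eq_bigr => b _.
by rewrite exchange_big; apply: eq_bigr => c _; exact: (tele n (fun a => F a b c)).
Qed.

Let teleb n F : sum3 n (fun a b c => F a b.+1 c - F a b c) =
  \sum_(a < n) \sum_(c < n) (F a n c - F a 0%N c).
Proof.
apply: eq_bigr => a _.
by rewrite exchange_big; apply: eq_bigr => c _; exact: (tele n (fun b => F a b c)).
Qed.

Let telec n F : sum3 n (fun a b c => F a b c.+1 - F a b c) =
  \sum_(a < n) \sum_(b < n) (F a b n - F a b 0%N).
Proof. by apply: eq_bigr => a _; apply: eq_bigr => b _; exact: (tele n (F a b)). Qed.

(* Each of the twelve edges of an octahedron is parallel to one other edge, on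
   which br has the opposite sign; every one of the six resulting sums
   telescopes to the faces of the box. *)
Lemma sum_oct n phi : (forall a b c, ~~ (a <= b <= c)%N -> phi a b c = 0) ->
  \sum_(a < n) \sum_(b < n) \sum_(c < n) oct phi a b c =
  tri n (phi 0%N) + tri n (fun a b => phi a b n)
  - \sum_(b < n) br (phi 0%N b n) (phi 0%N b.+1 n).
Proof.
move=> phi0.
pose E1 a b c := br (phi a b c.+1) (phi a.+1 b c).
pose E2 a b c := br (phi a b c) (phi a b.+1 c.+1).
pose E3 a b c := br (phi a.+1 b.+1 c) (phi a b c).
pose E4 a b c := br (phi a b c) (phi a b.+1 c).
pose E5 a b c := br (phi a b c) (phi a.+1 b c).
pose E6 a b c := br (phi a b c.+1) (phi a b c).
transitivity (- sum3 n (fun a b c => E1 a b.+1 c - E1 a b c)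
  + sum3 n (fun a b c => E2 a.+1 b c - E2 a b c)
  + sum3 n (fun a b c => E3 a b c.+1 - E3 a b c)
  + (sum3 n (fun a b c => E4 a b c.+1 - E4 a b c)
     - sum3 n (fun a b c => E4 a.+1 b c - E4 a b c))
  + (sum3 n (fun a b c => E5 a b.+1 c.+1 - E5 a b.+1 c)
     + sum3 n (fun a b c => E5 a b.+1 c - E5 a b c))
  + (sum3 n (fun a b c => E6 a.+1 b.+1 c - E6 a.+1 b c)
     + sum3 n (fun a b c => E6 a.+1 b c - E6 a b c))).
  have sum3N F : - sum3 n F = sum3 n (fun a b c => - F a b c).
    by rewrite /sum3 -sumrN; apply: eq_bigr => a _; rewrite -sumrN;
       apply: eq_bigr => b _; rewrite -sumrN.
  rewrite !sum3N -!sum3D; apply: eq_bigr => a _; apply: eq_bigr => b _.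
  apply: eq_bigr => c _; rewrite /oct /E1 /E2 /E3 /E4 /E5 /E6 /br /=; ring.
rewrite !telea !teleb !telec.
have sum2_0 (F : nat -> nat -> R) : (forall a b : 'I_n, F a b = 0) ->
    \sum_(a < n) \sum_(b < n) F a b = 0.
  by move=> F0; rewrite big1 // => a _; rewrite big1.
have z1 : \sum_(a < n) \sum_(c < n) (E1 a n c - E1 a 0%N c) = 0.
  apply: (sum2_0 (fun a c => E1 a n c - E1 a 0%N c)) => a c; rewrite /E1 !(phi0 a.+1) ?br0r ?subrr //=; have := ltn_ord c; lia.
have z5 : \sum_(a < n) \sum_(c < n) (E5 a n c - E5 a 0%N c) = 0.
  apply: (sum2_0 (fun a c => E5 a n c - E5 a 0%N c)) => a c; rewrite /E5 !(phi0 a.+1) ?br0r ?subrr //=; have := ltn_ord c; lia.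
have z6 : \sum_(a < n) \sum_(c < n) (E6 a.+1 n c - E6 a.+1 0%N c) = 0.
  by apply: (sum2_0 (fun a c => E6 a.+1 n c - E6 a.+1 0%N c)) => a c; rewrite /E6 !(phi0 a.+1 _ c) ?br0r ?subrr //=; have := ltn_ord c; lia.
have triE psi : tri n psi = \sum_(a < n) \sum_(b < n) br (psi a b.+1) (psi a.+1 b.+1)
    + \sum_(a < n) \sum_(b < n) br (psi a b) (psi a b.+1)
    + \sum_(a < n) \sum_(b < n) - br (psi a b) (psi a.+1 b.+1).
  by rewrite -!big_split; apply: eq_bigr => a _; rewrite -!big_split.
have z2 : \sum_(b < n) \sum_(c < n) (E2 n b c - E2 0%N b c) =
    \sum_(b < n) \sum_(c < n) - br (phi 0%N b c) (phi 0%N b.+1 c.+1).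
  apply: eq_bigr => b _; apply: eq_bigr => c _.
  by rewrite /E2 (phi0 n) ?br0l ?sub0r //; have := ltn_ord b; lia.
have z3 : \sum_(b < n) \sum_(c < n) (E3 b c n - E3 b c 0%N) =
    \sum_(b < n) \sum_(c < n) - br (phi b c n) (phi b.+1 c.+1 n).
  apply: eq_bigr => b _; apply: eq_bigr => c _.
  rewrite /E3 (phi0 _ _ 0%N) ?br0l ?subr0 //; last by have := ltn_ord b; lia.
  by rewrite /br; ring.
have z4 : \sum_(b < n) \sum_(c < n) (E4 b c n - E4 b c 0%N) =
    \sum_(b < n) \sum_(c < n) br (phi b c n) (phi b c.+1 n).
  apply: eq_bigr => b _; apply: eq_bigr => c _.
  by rewrite /E4 (phi0 _ _.+1 0%N) ?br0r ?subr0 //; lia.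
have z4' : \sum_(b < n) \sum_(c < n) (E4 n b c - E4 0%N b c) =
    \sum_(b < n) \sum_(c < n) - br (phi 0%N b c) (phi 0%N b.+1 c).
  apply: eq_bigr => b _; apply: eq_bigr => c _.
  by rewrite /E4 (phi0 n) ?br0l ?sub0r //; have := ltn_ord b; lia.
have z5' : \sum_(b < n) \sum_(c < n) (E5 b c.+1 n - E5 b c.+1 0%N) =
    \sum_(b < n) \sum_(c < n) br (phi b c.+1 n) (phi b.+1 c.+1 n).
  apply: eq_bigr => b _; apply: eq_bigr => c _.
  by rewrite /E5 (phi0 _.+1 _ 0%N) ?br0r ?subr0 //; lia.
have z6' : \sum_(b < n) \sum_(c < n) (E6 n b c - E6 0%N b c) =
    \sum_(b < n) \sum_(c < n) br (phi 0%N b c) (phi 0%N b c.+1).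
  apply: eq_bigr => b _; apply: eq_bigr => c _.
  rewrite /E6 (phi0 n) ?br0l ?sub0r //; last by have := ltn_ord b; lia.
  by rewrite /br; ring.
(* Shifting c to c + 1, as [tri] requires, telescopes and leaves the row c = n: the correction along
   the edge in the statement. *)
have z7 : \sum_(b < n) \sum_(c < n) - br (phi 0%N b c) (phi 0%N b.+1 c) =
    \sum_(b < n) \sum_(c < n) - br (phi 0%N b c.+1) (phi 0%N b.+1 c.+1)
    + \sum_(b < n) br (phi 0%N b n) (phi 0%N b.+1 n).
  rewrite -big_split; apply: eq_bigr => b _ /=.
  have := tele n (fun c => br (phi 0%N b c) (phi 0%N b.+1 c)).
  rewrite (phi0 _ b.+1 0%N) // br0r subr0 => <-.
  by rewrite -big_split; apply: eq_bigr => c _ /=; rewrite addrA addNr add0r.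
have z8 : - (\sum_(b < n) \sum_(c < n) - br (phi 0%N b c.+1) (phi 0%N b.+1 c.+1)) =
    \sum_(b < n) \sum_(c < n) br (phi 0%N b c.+1) (phi 0%N b.+1 c.+1).
  rewrite -sumrN; apply: eq_bigr => b _; rewrite -sumrN.
  by apply: eq_bigr => c _; rewrite opprK.
rewrite z1 z5 z6 z2 z3 z4 z4' z5' z6' z7 !triE opprD.
rewrite z8.
ring.
Qed.

(** For a = b < c the hypotheses give P = S, for a < b = c they give Q = S, and the cyclic sum
    vanishes by antisymmetry. For a = b = c they give S = P + Q, and a single [br] survives. In the
    remaining cases at most one of P, Q, S is nonzero. *)
Lemma oct_degenerate n phi a b c : (forall a b c, ~~ (a <= b <= c)%N -> phi a b c = 0) ->
  (forall a c, (a < c)%N -> (c <= n)%N -> phi a a c = phi a.+1 a.+1 c) ->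
  (forall a c, (a <= c)%N -> (c < n)%N -> phi a c c = phi a c.+1 c.+1) ->
  (a < n)%N -> (b < n)%N -> (c < n)%N ->
  ~~ (a < b < c)%N ->
  oct phi a b c = if (a == b) && (b == c) then br (phi a a a) (phi a.+1 a.+1 a.+1) else 0.
Proof.
move=> phi0 phi1 phi2 a_n b_n c_n nabc.
have [ab|ba|ab] := ltngtP a b.
- have cb : (c <= b)%N by rewrite ab in nabc; rewrite leqNgt.
  move: cb; rewrite leq_eqVlt => /predU1P[->|cb].
    rewrite /oct (phi0 a.+1 b.+1 b) ?(phi0 a b b.+2) //=; try lia.
    rewrite (phi2 a b) ?(phi2 a.+1 b) //; last by lia.
    by rewrite !addr0 /br /=; ring.
  rewrite /oct (phi0 a.+1 b.+1 c) ?(phi0 a.+1 b c) ?(phi0 a b c) ?(phi0 a.+1 b.+1 c.+1)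
     ?(phi0 a b.+1 c.+1) //; try lia.
  by rewrite !addr0 !br0r br0l !addr0.
- rewrite /oct (phi0 a.+1 b.+1 c) ?(phi0 a.+1 b c) ?(phi0 a b c) ?(phi0 a.+1 b.+1 c.+1)
     ?(phi0 a b c.+1) //; try lia.
  by rewrite !addr0 !br0r br0l !addr0.
subst b; have [ac|ca|ac] /= := ltngtP a c.
- rewrite /oct (phi0 a.+1 a c) //; last by lia.
  rewrite (phi1 a c) ?(phi1 a c.+1) ?(leqW ac) ?(ltnW c_n) //.
  by rewrite /br /=; ring.
- rewrite /oct (phi0 a.+1 a.+1 c) ?(phi0 a.+1 a c) ?(phi0 a a c) ?(phi0 a.+1 a.+1 c.+1)
     ?(phi0 a a.+1 c.+1) //; try lia.
  by rewrite !addr0 !br0r br0l !addr0.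
subst c; rewrite /oct (phi0 a.+1 a a) ?(phi0 a.+1 a.+1 a) //; try lia.
rewrite (phi1 a a.+1) // (phi2 a a) //.
by rewrite /br /=; ring.
Qed.

Lemma sum_oct_lt n phi : (forall a b c, ~~ (a <= b <= c)%N -> phi a b c = 0) ->
  (forall a c, (a < c)%N -> (c <= n)%N -> phi a a c = phi a.+1 a.+1 c) ->
  (forall a c, (a <= c)%N -> (c < n)%N -> phi a c c = phi a c.+1 c.+1) ->
  \sum_(a < n) \sum_(b < n) \sum_(c < n | (a < b < c)%N) oct phi a b c =
  tri n (phi 0%N) + tri n (fun a b => phi a b n)
  - \sum_(b < n) br (phi 0%N b n) (phi 0%N b.+1 n)
  - \sum_(a < n) br (phi a a a) (phi a.+1 a.+1 a.+1).
Proof.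
move=> phi0 phi1 phi2; rewrite -sum_oct //; apply/eqP; rewrite eq_sym subr_eq eq_sym.
apply/eqP; rewrite -big_split; apply: eq_bigr => a _ /=.
rewrite [X in _ + X](_ : _ = \sum_(b < n) \sum_(c < n | ~~ (a < b < c)%N) oct phi a b c).
  rewrite -big_split; apply: eq_bigr => b _ /=.
  by rewrite [RHS](bigID (fun c : 'I_n => (a < b < c)%N)).
under eq_bigr => b _ do under eq_bigr => c nabc do rewrite (oct_degenerate phi0 phi1 phi2) //.
rewrite (bigD1 a) //= [X in _ + X]big1 => [|b ba].
  rewrite addr0 (bigD1 a) /= ?ltnn // !eqxx big1 ?addr0 // => c /andP[_ ca].
  by rewrite eq_sym (inj_eq val_inj) (negPf ca).
by rewrite big1 // => c _; rewrite (inj_eq val_inj) eq_sym (negPf ba).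
Qed.

Lemma eq_tri n psi psi' :
  (forall a b, (a <= n)%N -> (b <= n)%N -> psi a b = psi' a b) -> tri n psi = tri n psi'.
Proof.
move=> E; apply: eq_bigr => a _; apply: eq_bigr => b _.
by have [an bn] := (ltn_ord a, ltn_ord b); rewrite !E // ltnW.
Qed.

(* The rotation (a, b) |-> (b - a, n - a) permutes the elementary triangles. *)
Lemma tri_rot n psi chi : (forall a b, (b < a)%N -> psi a b = 0) ->
  (forall a b, (b < a)%N -> chi a b = 0) ->
  (forall a b, (a <= b <= n)%N -> psi a b = chi (b - a)%N (n - a)%N) ->
  tri n psi = tri n chi.
Proof.
move=> psi0 chi0 psichi.
pose T (p q : nat) : R := br (chi p q.+1) (chi p.+1 q.+1) + br (chi p q) (chi p q.+1)
   - br (chi p q) (chi p.+1 q.+1).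
have rev1 (f : nat -> R) : \sum_(i < n) f i = \sum_(i < n) f (n.-1 - i)%N.
  rewrite (reindex_inj rev_ord_inj); apply: eq_bigr => i _ /=.
  by congr (f _); have := ltn_ord i; move: (val i) => j; clear; lia.
transitivity (\sum_(a < n) \sum_(p < n) T p (n.-1 - a)%N); last first.
  by rewrite -(rev1 (fun q => \sum_(p < n) T p q)) exchange_big.
apply: eq_bigr => a _; have an := ltn_ord a.
pose U b : R := br (psi a b.+1) (psi a.+1 b.+1) + br (psi a b) (psi a b.+1)
   - br (psi a b) (psi a.+1 b.+1).
have U0 b : (b < a)%N -> U b = 0.
  move=> ba; rewrite /U (psi0 a b) // (psi0 a.+1 b.+1) //.
  by rewrite br0r !br0l subr0 addr0.
have UT (p : nat) : (a + p < n)%N -> U (p + a)%N = T p (n.-1 - a)%N.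
  move=> apn; rewrite /U /T !psichi; try lia.
  rewrite (_ : (p + a).+1 - a = p.+1)%N; last lia.
  rewrite (_ : (p + a).+1 - a.+1 = p)%N; last lia.
  rewrite addnK (_ : n - a = (n.-1 - a).+1)%N; last lia.
  rewrite (_ : n - a.+1 = n.-1 - a)%N; last lia.
  by rewrite /br; ring.
have T0 (p : nat) : (n - a <= p)%N -> T p (n.-1 - a)%N = 0.
  move=> nap; rewrite /T (chi0 p (n.-1 - a)%N); last lia.
  rewrite (chi0 p.+1 (n.-1 - a).+1); last lia.
  by rewrite br0r !br0l subr0 addr0.
rewrite -(big_mkord xpredT U) -(big_mkord xpredT (fun p => T p (n.-1 - a)%N)).
rewrite (@big_cat_nat _ _ _ a) ?(ltnW an) //= big1_seq ?add0r => [|b]; last first.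
  by rewrite mem_index_iota => /andP[_ /andP[_ /U0]].
rewrite [RHS](@big_cat_nat _ _ _ (n - a)) ?leq_subr //= [X in _ + X]big1_seq ?addr0 => [|b].
  rewrite -{1}[val a]add0n big_addn; apply: eq_big_nat => p /andP[_ pna]; apply: UT.
  by rewrite -ltn_subRL.
by rewrite mem_index_iota => /andP[_ /andP[/T0]].
Qed.

End Octahedra.

(** * Matrices and their entries *)

Section Entries.
Variables (R : realType) (n : nat).
Implicit Types (M G A : 'M[R]_n) (s t : seq nat).

Definition ent M i j : R :=
  if insub i is Some i' then if insub j is Some j' then M i' j' else 0 else 0.

Lemma entE M (i j : 'I_n) : ent M i j = M i j.
Proof. by rewrite /ent !valK. Qed.

Lemma eq_mn (m m' : nat -> nat -> R) s t : size s = size t ->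
  (forall i j, i \in s -> j \in t -> m i j = m' i j) -> mn m s t = mn m' s t.
Proof.
by move=> st mm'; apply: eq_dt => i j si sj; apply: mm'; apply: mem_nth; rewrite -?st.
Qed.

Lemma slist_lt s i : slist n s -> i \in s -> (i < n)%N.
Proof. by case/andP => _ /allP /[apply]. Qed.

Lemma ent_mulmx A G i j : (i < n)%N -> (j < n)%N ->
  ent (A *m G) i j = mulm n (ent A) (ent G) i j.
Proof.
move=> i_n j_n; rewrite -[i]/(val (Ordinal i_n)) -[j]/(val (Ordinal j_n)) entE mxE.
by apply: eq_bigr => l _; rewrite !entE.
Qed.

Definition vals k (f : 'I_k -> 'I_n) : seq nat := [seq val (f i) | i <- enum 'I_k].

Lemma size_vals k (f : 'I_k -> 'I_n) : size (vals f) = k.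
Proof. by rewrite size_map size_enum_ord. Qed.

Lemma nth_vals k (f : 'I_k -> 'I_n) (i : 'I_k) : nth 0%N (vals f) i = f i.
Proof. by rewrite (nth_map i) ?size_enum_ord // nth_ord_enum. Qed.

Lemma minor_mn k (f g : 'I_k -> 'I_n) M : minor f g M = mn (ent M) (vals f) (vals g).
Proof.
rewrite /minor /mn size_vals; congr (\det _); apply/matrixP => i j.
by rewrite !mxE !nth_vals entE.
Qed.

Lemma slist_vals k (f : 'I_k -> 'I_n) : {homo f : i j / (i < j)%N} -> slist n (vals f).
Proof.
move=> fh; apply/andP; split; last by apply/allP => _ /mapP[i _ ->] /=.
apply: (@homo_sorted _ _ (val \o f) (fun i j : 'I_k => (i < j)%N)) => [i j /fh //|].
by have := iota_ltn_sorted 0 k; rewrite -val_enum_ord sorted_map.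
Qed.

Lemma Bgroup_upper G : Bgroup G -> upper n (ent G).
Proof.
case=> /is_trig_mxP tG _ i j ji i_n; have j_n := ltn_trans ji i_n.
rewrite -[i]/(val (Ordinal i_n)) -[j]/(val (Ordinal j_n)) entE.
by have := tG (Ordinal j_n) (Ordinal i_n) ji; rewrite mxE.
Qed.

Lemma NgroupP M : Ngroup M <-> unitri n (ent M).
Proof.
split=> [[MB M1]|[um m1]].
  split=> [|i i_n]; first exact: Bgroup_upper.
  by rewrite -[i]/(val (Ordinal i_n)) entE M1.
have tM : is_trig_mx M^T.
  by apply/is_trig_mxP => i j ij; rewrite mxE -entE um.
split=> [|i]; last by rewrite -entE m1.
split=> //; rewrite unitmxE -det_tr det_trig // big1 ?unitr1 // => i _.
by rewrite mxE -entE m1.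
Qed.

(* The (s, t) submatrix of the witness is lower triangular with positive diagonal. *)
Lemma minor_not_identically_0 s t : slist n s -> slist n t -> all2 leq s t ->
  exists2 H : 'M[R]_n, Bgroup H & mn (ent H) s t != 0.
Proof.
move=> sl tl lst; have sz := all2_leq_size lst.
pose h i j : R := (i == j)%:R + ((i, j) \in zip s t)%:R.
have hpos i : 0 < h i i by rewrite /h eqxx ltr_wpDr ?ler0n ?ltr01.
have zP i j : (i, j) \in zip s t -> exists2 l, (l < size s)%N & i = nth 0%N s l /\ j = nth 0%N t l.
  move=> /(nthP (0%N, 0%N))[l]; rewrite size_zip -sz minnn => ls.
  by rewrite nth_zip // => -[<- <-]; exists l.
have hup i j : (j < i)%N -> h i j = 0.
  move=> ji; rewrite /h gtn_eqF // add0r; case: (boolP (_ \in _)) => // /zP[l ls [ei ej]].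
  by have := all2_leq_nth l lst; rewrite -ei -ej leqNgt ji.
pose H : 'M[R]_n := \matrix_(i, j) h i j.
have EH i j : (i < n)%N -> (j < n)%N -> ent H i j = h i j.
  by move=> i_n j_n; rewrite -[i]/(val (Ordinal i_n)) -[j]/(val (Ordinal j_n)) entE mxE.
have tH : is_trig_mx H^T by apply/is_trig_mxP => i j ij; rewrite !mxE hup.
exists H.
  split=> //; rewrite unitmxE -det_tr det_trig // unitfE; apply/prodf_neq0 => i _.
  by rewrite !mxE gt_eqF.
rewrite (@eq_mn _ h) // => [|i j i_s j_t]; last first.
  by rewrite EH //; [exact: (slist_lt sl i_s)|exact: (slist_lt tl j_t)].
rewrite /mn dt_trig => [|i j ij js].
  apply/prodf_neq0 => i _; rewrite /h gt_eqF // ltr_wpDl ?ler0n // ltr0n lt0b.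
  rewrite -nth_zip //; apply: mem_nth; rewrite size_zip -sz minnn //.
have [[sos _] [sot _]] := (andP sl, andP tl).
have jt : (j < size t)%N by rewrite -sz.
have si := ltn_trans ij js.
have nss l l' : (l < size s)%N -> (l' < size s)%N -> nth 0%N s l = nth 0%N s l' -> l = l'.
  move=> ls ls' /eqP; rewrite nth_uniq ?(sorted_uniq ltn_trans ltnn) //.
  by move/eqP.
have ntt l l' : (l < size t)%N -> (l' < size t)%N -> nth 0%N t l = nth 0%N t l' -> l = l'.
  move=> ls ls' /eqP; rewrite nth_uniq ?(sorted_uniq ltn_trans ltnn) //.
  by move/eqP.
rewrite /h ltn_eqF ?add0r; last first.
  by apply: leq_trans (all2_leq_nth j lst); exact: sorted_nth.
case: (boolP (_ \in _)) => // /zP[l ls [/nss E1 /ntt E2]].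
by move: ij; rewrite E1 // E2 ?ltnn // -sz.
Qed.

Lemma totally_positiveP M : upper n (ent M) -> totally_positive M <-> tp n (ent M).
Proof.
move=> uM; split=> [tM s t sl tl lst|tM k f g fh gh [H HB]].
  have sz := all2_leq_size lst.
  have fP u (i : 'I_(size s)) : slist n u -> size u = size s -> (nth 0%N u i < n)%N.
    by move=> ul us; apply: (slist_lt ul); rewrite mem_nth ?us.
  pose f i := Ordinal (fP s i sl erefl).
  pose g i := Ordinal (fP t i tl (esym sz)).
  have vu u ul us : vals (fun i => Ordinal (fP u i ul us)) = u.
    apply: (@eq_from_nth _ 0%N); rewrite size_vals // => i si.
    by rewrite -[i]/(val (Ordinal si)) nth_vals.
  have hu u ul us : {homo (fun i => Ordinal (fP u i ul us)) : i j / (i < j)%N}.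
    move=> i j ij /=; apply: sorted_nth => //; first by case/andP: ul.
    by rewrite us.
  have [H HB] := minor_not_identically_0 sl tl lst.
  have := tM _ f g (hu _ _ _) (hu _ _ _); rewrite !minor_mn /f /g !vu => h ?.
  by apply: h; exists H; rewrite // minor_mn !vu.
rewrite !minor_mn => Hne0; apply: tM; try exact: slist_vals.
apply: contraNT Hne0 => nle; rewrite (mn_vanish (Bgroup_upper HB)) ?size_vals ?slist_vals //.
by case/andP: (slist_vals gh).
Qed.

Lemma NplusP M : Nplus M <-> unitri n (ent M) /\ tp n (ent M).
Proof.
split=> [[/NgroupP uM tM]|[uM tM]].
  by split=> //; apply/totally_positiveP => //; case: uM.
by split; [apply/NgroupP | apply/totally_positiveP => //; case: uM].
Qed.

End Entries.

(** * The factorization defining the two primes *)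

Section SList.
Variable n : nat.

Lemma slist_bound x s : slist n (x :: s) -> (x + size (x :: s) <= n)%N.
Proof.
elim: s x => [|y s IH] x; first by rewrite /slist /= andbT addn1.
move=> h; have /IH /= : slist n (y :: s) by apply: slist_sub h; exact: subseq_cons.
by case/andP: h => /= /andP[xy _] _; rewrite !addnS; apply: leq_trans; rewrite !ltnS ltn_add2r.
Qed.

Lemma size_slist s : slist n s -> (size s <= n)%N.
Proof.
by case: s => // x s /slist_bound; apply: leq_trans; rewrite leq_addl.
Qed.

Lemma slist_leq_last s : slist n s -> all2 leq s (iota (n - size s) (size s)).
Proof.
elim: s => // x s IH h; have b := slist_bound h.
have hs : slist n s by apply: slist_sub h; exact: subseq_cons.
rewrite /= -[all2 _ _ _]/(all2 leq s (iota (n - size (x :: s)).+1 (size s))).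
have -> : ((n - size (x :: s)).+1 = n - size s)%N by move: b => /=; lia.
by rewrite IH // andbT leq_subRL; move: b => /=; lia.
Qed.

End SList.

Section Ratio.
Variables (R : realFieldType) (n : nat).
Implicit Types (m A L X : nat -> nat -> R) (s : seq nat).

Lemma DL_gt0 m s : tp n m -> slist n s -> 0 < DL n m s.
Proof.
move=> tm sl; apply: tm => //; last exact: slist_leq_last.
by apply: slist_iota; rewrite subnK ?size_slist.
Qed.

Lemma DL_last m k : unitri n m -> (k <= n)%N -> DL n m (iota (n - k) k) = 1.
Proof.
move=> um kn; rewrite /DL size_iota; apply: mn_diag um _.
by apply: slist_iota; rewrite subnK.
Qed.

(** The factor of [DL_mulm_lower] is read off at the last rows, where the flag minor of a unipotent
    matrix is 1. *)
Lemma DL_mulm_unitri A L s : unitri n A -> (forall i j, (i < j)%N -> L i j = 0) ->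
  slist n s ->
  DL n (mulm n A L) s = DL n A s * DL n (mulm n A L) (iota (n - size s) (size s)).
Proof.
move=> uA lL sl; have sn := size_slist sl.
by rewrite !DL_mulm_lower ?size_iota // (DL_last uA sn) mul1r.
Qed.

Lemma DL_mulm_unitri_r X L s : unitri n (mulm n X L) -> (forall i j, (i < j)%N -> L i j = 0) ->
  slist n s ->
  DL n X s = DL n (mulm n X L) s * DL n X (iota (n - size s) (size s)).
Proof.
move=> uX lL sl; have sn := size_slist sl.
have := DL_last uX sn; rewrite !DL_mulm_lower ?size_iota // => E.
by rewrite -mulrA [X in _ = _ * X]mulrC E mulr1.
Qed.

Lemma DL_rev m s : slist n s ->
  DL n (fun i j => m (n.-1 - i)%N j) s = sgrev R (size s) * DL n m (wrev n s).
Proof.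
move=> sl; rewrite /DL size_wrev /wrev mn_rev size_map mulrA sgrev_sqr mul1r.
by rewrite -[in RHS](map_id (iota _ _)) mn_map // size_iota.
Qed.

Lemma wrev_last k : (k <= n)%N -> wrev n (iota (n - k) k) = iota 0 k.
Proof. by move=> kn; rewrite wrev_iota ?subnK // subnn. Qed.

Lemma eq_DL m m' s : slist n s -> (forall i j, (i < n)%N -> (j < n)%N -> m i j = m' i j) ->
  DL n m s = DL n m' s.
Proof.
move=> sl mm'; have sn := size_slist sl.
apply: eq_dt => i j si _; apply: mm'.
  by case/andP: sl => _ /allP; apply; exact: mem_nth.
case: (ltnP j (size s)) => js; first by rewrite nth_iota // -ltn_subRL subKn.
by rewrite nth_default ?size_iota //; apply: leq_trans sn; case: (size s) si.
Qed.

Lemma eq_unitri m m' : (forall i j, (i < n)%N -> (j < n)%N -> m i j = m' i j) ->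
  unitri n m -> unitri n m'.
Proof.
move=> mm' [um m1]; split=> [i j ji i_n|i i_n]; last by rewrite -mm' ?m1.
by rewrite -mm' ?um // (ltn_trans ji).
Qed.

Lemma eq_tp m m' : (forall i j, (i < n)%N -> (j < n)%N -> m i j = m' i j) ->
  tp n m -> tp n m'.
Proof.
move=> mm' tm s t sl tl lst; rewrite [mn _ _ _](_ : _ = mn m s t); first exact: tm.
apply/esym; apply: eq_dt => i j si sj; apply: mm'.
  by case/andP: sl => _ /allP; apply; exact: mem_nth.
by case/andP: tl => _ /allP; apply; apply: mem_nth; rewrite -(all2_leq_size lst).
Qed.

End Ratio.

Section Factorization.
Variables (R : realType) (n : nat).
Implicit Types (M X A G : 'M[R]_n) (s : seq nat).

Notation P := (antidiag R n).

Lemma antidiag_mulE M i j : (P *m M) i j = M (rev_ord i) j.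
Proof.
rewrite mxE (bigD1 (rev_ord i)) //= big1 ?addr0 => [|l li].
  by rewrite mxE /= (_ : _ == _) ?mul1r //; have := ltn_ord i; lia.
rewrite mxE (_ : _ == _ = false) ?mul0r //; apply/eqP => E; case/eqP: li.
by apply/val_inj => /=; have := ltn_ord i; lia.
Qed.

Lemma antidiagT : P^T = P.
Proof. by apply/matrixP => i j; rewrite !mxE addnC. Qed.

Lemma antidiagK : P *m P = 1%:M.
Proof.
apply/matrixP => i j; rewrite antidiag_mulE !mxE -val_eqE /=; congr (_%:R).
by congr nat_of_bool; have := ltn_ord i; have := ltn_ord j; lia.
Qed.

Lemma mul_antidiagE M i j : (M *m P) i j = M i (rev_ord j).
Proof.
transitivity ((M *m P)^T j i); first by rewrite [RHS]mxE.
by rewrite trmx_mul antidiagT antidiag_mulE mxE.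
Qed.

Definition taumx M := P *m M^T *m P.

Lemma taumxK M : taumx (taumx M) = M.
Proof.
rewrite /taumx !trmx_mul antidiagT trmxK !mulmxA antidiagK mul1mx -!mulmxA.
by rewrite antidiagK mulmx1.
Qed.

Lemma ent_antidiag M i j : (i < n)%N -> (j < n)%N ->
  ent (P *m M) i j = ent M (n.-1 - i)%N j.
Proof.
move=> i_n j_n; rewrite -[i]/(val (Ordinal i_n)) -[j]/(val (Ordinal j_n)) entE.
rewrite antidiag_mulE -entE /=; congr (ent _ _ _); lia.
Qed.

Lemma ent_taumx M i j : (i < n)%N -> (j < n)%N -> ent (taumx M) i j = tau n (ent M) i j.
Proof.
move=> i_n j_n; rewrite /tau.
rewrite -[in LHS](_ : val (Ordinal i_n) = i) // -[in LHS](_ : val (Ordinal j_n) = j) // entE.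
rewrite mul_antidiagE antidiag_mulE mxE -entE /=; congr (ent _ _ _); lia.
Qed.

Lemma Ngroup_tau M : Ngroup M -> Ngroup (taumx M).
Proof.
move=> /NgroupP uM; apply/NgroupP; apply: eq_unitri (unitri_tau uM) => i j i_n j_n.
by rewrite ent_taumx.
Qed.

Lemma Nplus_tau M : Nplus M -> Nplus (taumx M).
Proof.
move=> /NplusP[uM tM]; apply/NplusP; split.
  by apply/NgroupP/Ngroup_tau/NgroupP.
by apply: eq_tp (tp_tau tM) => i j i_n j_n; rewrite ent_taumx.
Qed.

Definition factors M A G := exists d : 'rV[R]_n, P *m M *m P = A *m P *m diag_mx d *m G.

(** Transposing and conjugating by the antidiagonal reverses the product, so the second factor of M
    becomes the first factor of the reflected matrix. Results on M' thereby carry over to M''. *)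
Lemma factors_tau M A G : factors M A G -> factors (taumx M) (taumx G) (taumx A).
Proof.
case=> d E; exists d.
have -> : P *m taumx M *m P = M^T.
  by rewrite /taumx !mulmxA antidiagK mul1mx -!mulmxA antidiagK mulmx1.
have /(congr1 trmx) : M = P *m (A *m P *m diag_mx d *m G) *m P.
  by rewrite -E !mulmxA antidiagK mul1mx -!mulmxA antidiagK mulmx1.
rewrite !trmx_mul tr_diag_mx antidiagT => ->.
by rewrite /taumx !mulmxA -(mulmxA _ P P) antidiagK mulmx1.
Qed.

Lemma diag_upper_lower (d : 'rV[R]_n) G : Ngroup G ->
  forall i j, (i < j)%N -> ent (P *m diag_mx d *m G *m P) i j = 0.
Proof.
move=> [NG _] i j ij; rewrite /ent; case: insubP => // i' i_n Ei; case: insubP => // j' j_n Ej.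
rewrite mul_antidiagE -mulmxA antidiag_mulE mul_diag_mx mxE -entE.
have iEi : nat_of_ord i' = i by []; have jEj : nat_of_ord j' = j by [].
by rewrite (Bgroup_upper NG) ?mulr0 //= ?iEi ?jEj; have := ltn_ord i'; have := ltn_ord j'; lia.
Qed.

(** The factorization says $PM = AL$ with $L = PD_MGP$ lower triangular, so A has the flag minors of
    $PM$ up to a factor fixed by the size. Passing from $PM$ to M reverses the rows; the sign of the
    reversal appears on both sides and cancels. *)
Lemma factors_DL M A G s : Ngroup A -> Ngroup G -> factors M A G -> slist n s ->
  DL n (ent M) (wrev n s) = DL n (ent A) s * DL n (ent M) (iota 0 (size s)).
Proof.
move=> NA NG [d E] sl; have sn := size_slist sl.
pose L := P *m diag_mx d *m G *m P.
have E1 : P *m M = A *m L.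
  by rewrite /L !mulmxA -E -mulmxA antidiagK mulmx1.
have E2 i j : (i < n)%N -> (j < n)%N ->
    ent M (n.-1 - i)%N j = mulm n (ent A) (ent L) i j.
  by move=> i_n j_n; rewrite -ent_antidiag // E1 ent_mulmx.
have EX u : slist n u -> DL n (mulm n (ent A) (ent L)) u =
    sgrev R (size u) * DL n (ent M) (wrev n u).
  by move=> ul; rewrite -DL_rev //; apply: eq_DL => // i j i_n j_n; rewrite E2.
have sl' : slist n (iota (n - size s) (size s)) by apply: slist_iota; rewrite subnK.
have := DL_mulm_unitri (proj1 (NgroupP A) NA) (diag_upper_lower d NG) sl.
rewrite -/L !EX // size_iota wrev_last // => /(congr1 ( *%R (sgrev R (size s)))).
by rewrite mulrA sgrev_sqr mul1r mulrCA [X in _ * X]mulrA sgrev_sqr mul1r.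
Qed.

(** Elimination by Cramer's rule. Column j of the product has at i the minor with rows i, j+1, ...,
    n-1 and columns j, ..., n-1, divided by its value at i = j: it is 1 at i = j and vanishes for i
    > j by a repeated row. Its expansion along row i gives the coefficients of [L]. *)
Lemma UL_exists X : (forall j, (j <= n)%N -> DL n (ent X) (iota j (n - j)) != 0) ->
  exists L : 'M[R]_n, [/\ is_trig_mx L, forall i, L i i != 0 & Ngroup (X *m L)].
Proof.
pose T j := iota j (n - j).
have TS j : (j < n)%N -> T j = j :: T j.+1 by move=> j_n; rewrite /T -(subnSK j_n).
move=> DX; have DT j : (j <= n)%N -> mn (ent X) (T j) (T j) != 0.
  by move=> j_n; have := DX j j_n; rewrite /DL size_iota subKn.
pose l k j := if (j <= k)%N then cf (ent X) (T j.+1) (T j) (k - j) / mn (ent X) (T j) (T j) else 0.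
pose L : 'M[R]_n := \matrix_(k, j) l k j.
have XL i j : (X *m L) i j = mn (ent X) (val i :: T j.+1) (T j) / mn (ent X) (T j) (T j).
  have j_n := ltn_ord j.
  rewrite mn_cons size_iota subnSK // mulr_suml mxE.
  rewrite (eq_bigr (fun k : 'I_n => ent X i k * l k j)) => [|k _]; last by rewrite entE mxE.
  rewrite -(big_mkord xpredT (fun k => ent X i k * l k j)).
  rewrite (@big_cat_nat _ _ _ j) //= ?(ltnW j_n) // big1_seq ?add0r => [|k]; last first.
    by rewrite mem_index_iota /l => /andP[_] /andP[_ kj]; rewrite leqNgt kj mulr0.
  rewrite -{1}[val j]add0n big_addn big_mkord; apply: eq_bigr => k _.
  by rewrite /l leq_addl addnK nth_iota // addnC mulrA.
exists L; split.
- by apply/is_trig_mxP => i j ij; rewrite mxE /l leqNgt ij.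
- move=> i; have i_n := ltn_ord i; rewrite mxE /l leqnn subnn mulf_neq0 ?invr_neq0 ?DT ?(ltnW i_n) //.
  rewrite /cf expr0 mul1r.
  rewrite [dt _ _](_ : _ = mn (ent X) (T i.+1) (T i.+1)) ?DT //.
  by apply: eq_dt => a b _ _; rewrite (TS i).
apply/NgroupP; split=> [i j ji i_n|i i_n].
  have j_n := ltn_trans ji i_n; rewrite -[i]/(val (Ordinal i_n)) -[j]/(val (Ordinal j_n)) entE XL /=.
  by rewrite mn_row_mem ?mul0r // mem_iota ji subnKC.
by rewrite -[i]/(val (Ordinal i_n)) entE XL /= -TS // divff // DT // ltnW.
Qed.

Lemma trig_invmx (L : 'M[R]_n) : is_trig_mx L -> (forall i, L i i != 0) ->
  [/\ L \in unitmx, is_trig_mx (invmx L) & forall i, invmx L i i != 0].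
Proof.
move=> tL L0; have uL : L \in unitmx.
  by rewrite unitmxE det_trig // unitfE; apply/prodf_neq0.
have LV i j : \sum_k L i k * invmx L k j = (i == j)%:R.
  by have /matrixP/(_ i j) := mulmxV uL; rewrite !mxE.
have tV : is_trig_mx (invmx L).
  apply/is_trig_mxP => i j; have [k] := ubnP (val i); elim: k i => // k IHk i ik ij.
  have := LV i j; rewrite (bigD1 i) //= big1 => [|l li].
    rewrite addr0 -val_eqE ltn_eqF // => /eqP; rewrite mulf_eq0 (negPf (L0 i)) /=.
    by move/eqP.
  have [il|li'] := ltnP i l; first by move/is_trig_mxP: tL => ->; rewrite ?mul0r.
  have li2 : (l < i)%N by rewrite ltn_neqAle li' val_eqE li.
  rewrite (IHk l) ?mulr0 //; first exact: leq_trans li2 _.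
  exact: ltn_trans ij.
split=> // i; have := LV i i; rewrite (bigD1 i) //= big1 ?addr0 => [|l li].
  by rewrite eqxx => E; apply: contra_eq_neq E => ->; rewrite mulr0 eq_sym oner_eq0.
have [il|li'] := ltnP i l; first by move/is_trig_mxP: tL => ->; rewrite ?mul0r.
move/is_trig_mxP: tV => ->; rewrite ?mulr0 //.
by rewrite ltn_neqAle li' val_eqE li.
Qed.

Lemma Nplus_of_DL A : Ngroup A -> (forall s, slist n s -> 0 < DL n (ent A) s) -> Nplus A.
Proof. by move=> /NgroupP uA DA; apply/NplusP; split=> //; exact: cryer. Qed.

(** By [factors_DL] the flag minors of A are ratios of flag minors of M, hence positive, and Cryer's
    criterion applies. *)
Lemma factors_Nplus M A G : Nplus M -> Ngroup A -> Ngroup G -> factors M A G -> Nplus A.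
Proof.
move=> /NplusP[uM tM] NA NG F; apply: Nplus_of_DL => // s sl.
have sn := size_slist sl.
have h1 : 0 < DL n (ent M) (iota 0 (size s)) by apply: DL_gt0 => //; apply: slist_iota.
have : 0 < DL n (ent M) (wrev n s) by apply: DL_gt0 => //; exact: slist_wrev.
by rewrite (factors_DL NA NG F sl) pmulr_lgt0.
Qed.

Lemma factor_pair_exists M : Nplus M -> exists p, factor_pair M p.
Proof.
move=> NM; have /NplusP[uM tM] := NM.
have [j j_n|L [tL L0 NA]] := @UL_exists (P *m M).
  have slj : slist n (iota j (n - j)) by apply: slist_iota; rewrite subnKC.
  rewrite (@eq_DL _ _ _ (fun i j => ent M (n.-1 - i)%N j)) //; last exact: ent_antidiag.
  rewrite DL_rev // mulf_neq0 //; last first.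
    by rewrite gt_eqF // DL_gt0 // slist_wrev.
  apply/eqP => s0; have := sgrev_sqr R (size (iota j (n - j))).
  by rewrite s0 mul0r => /esym/eqP; rewrite oner_eq0.
have [uL tV V0] := trig_invmx tL L0.
(* With $A = PML$ one has $PMP = APW$. [W] is upper triangular, and [d] and [G] split it into its
   diagonal and a unipotent matrix. *)
pose W := P *m invmx L *m P.
pose d : 'rV[R]_n := \row_i W i i.
pose G := diag_mx (\row_i (d 0 i)^-1) *m W.
have WE i j : W i j = invmx L (rev_ord i) (rev_ord j) by rewrite /W mul_antidiagE antidiag_mulE.
have W0 i : W i i != 0 by rewrite WE.
have GE i j : G i j = (W i i)^-1 * W i j by rewrite /G mul_diag_mx !mxE.
have NG : Ngroup G.
  apply/NgroupP; split=> [i j ji i_n|i i_n].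
    have j_n := ltn_trans ji i_n; rewrite -[i]/(val (Ordinal i_n)) -[j]/(val (Ordinal j_n)) entE GE.
    rewrite [W _ (Ordinal j_n)]WE; move/is_trig_mxP: tV => -> /=; rewrite ?mulr0 //.
    by move: ji i_n; clear; lia.
  by rewrite -[i]/(val (Ordinal i_n)) entE GE mulVf.
have F : factors M (P *m M *m L) G.
  exists d; rewrite /G -!mulmxA (mulmxA (diag_mx d)) mulmx_diag.
  rewrite (_ : \row_i _ = const_mx 1) ?diag_const_mx ?mul1mx; last first.
    apply/rowP => i; have dE : d 0 i = W i i by rewrite mxE.
    by rewrite [LHS]mxE [X in _ * X]mxE dE divff // [RHS]mxE.
  by rewrite /W -!mulmxA (mulmxA P P) antidiagK mul1mx (mulmxA L) mulmxV // mul1mx.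
have NpA := factors_Nplus NM NA NG F.
(* In the reflected factorization G is the first factor, up to reflection, so the same criterion
   covers it. *)
have NpG : Nplus G.
  rewrite -[G]taumxK; apply: Nplus_tau.
  by apply: factors_Nplus (Nplus_tau NM) _ _ (factors_tau F); apply: Ngroup_tau.
by exists (P *m M *m L, G); split.
Qed.

Lemma primes_factor M : Nplus M ->
  [/\ Nplus (prime1 M), Nplus (prime2 M) & factors M (prime1 M) (prime2 M)].
Proof.
by move=> /factor_pair_exists[p Mp]; have [] := xgetPex (1%:M, 1%:M) (ex_intro _ p Mp).
Qed.

End Factorization.

(** * The Y-variables *)

Section FlagLists.
Variables (R : realType) (n : nat).
Implicit Types (M A G : 'M[R]_n) (I J : {set 'I_n}) (s : seq nat).

(* The rows of the minors in YL (gs) and in tYL (ks), numbered from 0; for DeltaU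
   reflection in the antidiagonal exchanges gs and ks. *)
Definition gs a b c : seq nat := iota a (b - a) ++ iota c (n - c).
Definition ks a b c : seq nat := iota 0 a ++ iota b (c - b).

Lemma slist_gs a b c : (a <= b)%N -> (b <= c)%N -> (c <= n)%N -> slist n (gs a b c).
Proof.
move=> ab bc cn; rewrite /slist sorted_cat_iota ?iota_ltn_sorted //=; last first.
  by apply/allP => i; rewrite mem_iota /= subnKC // => /andP[_ ib]; apply: leq_trans bc.
apply/allP => i; rewrite mem_cat !mem_iota !subnKC // => /orP[/andP[_ ib]|/andP[]//].
by rewrite /= (leq_trans ib) // (leq_trans bc).
Qed.

Lemma slist_ks a b c : (a <= b)%N -> (b <= c)%N -> (c <= n)%N -> slist n (ks a b c).
Proof.
move=> ab bc cn; rewrite /slist sorted_cat_iota ?iota_ltn_sorted //=; last first.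
  by apply/allP => i; rewrite mem_iota /= add0n => ia; apply: leq_trans ab.
apply/allP => i; rewrite mem_cat !mem_iota !subnKC //= add0n => /orP[ia|/andP[_ ic]].
  by apply: (leq_trans ia); apply: leq_trans cn; apply: leq_trans bc.
exact: leq_trans cn.
Qed.

Lemma size_gs a b c : size (gs a b c) = ((b - a) + (n - c))%N.
Proof. by rewrite size_cat !size_iota. Qed.

Lemma size_ks a b c : size (ks a b c) = (a + (c - b))%N.
Proof. by rewrite size_cat !size_iota. Qed.

Lemma wrev_gs a b c : (a <= b)%N -> (b <= c)%N -> (c <= n)%N ->
  wrev n (gs a b c) = ks (n - c) (n - b) (n - a).
Proof.
move=> ab bc cn; rewrite /gs /ks wrev_cat !wrev_iota ?subnKC ?(leq_trans bc) //.
by rewrite subnn; congr (_ ++ iota _ _); lia.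
Qed.

Lemma wrev_ks a b c : (a <= b)%N -> (b <= c)%N -> (c <= n)%N ->
  wrev n (ks a b c) = gs (n - c) (n - b) (n - a).
Proof.
move=> ab bc cn; rewrite /gs /ks wrev_cat !wrev_iota ?subnKC ?add0n //; try lia.
by congr (iota _ _ ++ iota _ _); lia.
Qed.

Definition setl I : seq nat := [seq val i | i <- enum I].

Lemma slist_setl I : slist n (setl I).
Proof.
apply/andP; split; last by apply/allP => _ /mapP[i _ ->] /=.
rewrite sorted_map sorted_filter //; first by move=> x y z /=; exact: ltn_trans.
by have := iota_ltn_sorted 0 n; rewrite -val_enum_ord sorted_map enumT.
Qed.

Lemma setlE I s : slist n s -> (forall i : 'I_n, (i \in I) = (val i \in s)) -> setl I = s.
Proof.
move=> sl Is; apply: (irr_sorted_eq ltn_trans ltnn).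
- by case/andP: (slist_setl I).
- by case/andP: sl.
move=> i; apply/mapP/idP => [[j + ->]|i_s]; first by rewrite mem_enum Is.
by exists (Ordinal (slist_lt sl i_s)) => //; rewrite mem_enum Is.
Qed.

Lemma vals_enum_val I : vals (fun i : 'I_#|I| => enum_val i) = setl I.
Proof.
apply: (@eq_from_nth _ 0%N); rewrite size_vals ?size_map -?cardE // => i iI.
rewrite -[i]/(val (Ordinal iI)) nth_vals (enum_val_nth (enum_val (Ordinal iI))).
by rewrite [RHS](nth_map (enum_val (Ordinal iI))) -?cardE.
Qed.

Lemma DeltaL_DL I M : DeltaL I M = DL n (ent M) (setl I).
Proof.
rewrite /DeltaL minor_mn vals_enum_val /DL; congr (mn _ _ _).
have IE : size (setl I) = #|I| by rewrite size_map -cardE.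
apply: (@eq_from_nth _ 0%N); rewrite size_vals ?size_iota ?IE // => i iI.
rewrite -[i in LHS]/(val (Ordinal iI)) nth_vals nth_iota //=.
by move: (card_set_ord_leq I) iI; move: #|I| => k kn ik; lia.
Qed.

Lemma DeltaU_DL J M : DeltaU J M = DL n (ent (taumx M)) (wrev n (setl J)).
Proof.
have sl := slist_setl J; have sn := size_slist sl.
have JE : size (setl J) = #|J| by rewrite size_map -cardE.
rewrite /DeltaU minor_mn vals_enum_val.
rewrite (eq_DL (m' := tau n (ent M)) (slist_wrev sl)); last by move=> *; rewrite ent_taumx.
rewrite /DL size_wrev mn_tau ?size_wrev ?size_iota // wrev_last // wrevK; last by case/andP: sl.
congr (mn _ _ _); apply: (@eq_from_nth _ 0%N); rewrite size_vals ?size_iota ?JE // => i iI.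
by rewrite -[i in LHS]/(val (Ordinal iI)) nth_vals nth_iota.
Qed.

Lemma setl_gs a b c : (a <= b)%N -> (b <= c)%N -> (c <= n)%N ->
  setl (idx_itv n a.+1 b :|: idx_itv n c.+1 n) = gs a b c.
Proof.
move=> ab bc cn; apply: setlE; first exact: slist_gs.
by move=> i; rewrite !inE mem_cat !mem_iota !subnKC // !ltnS.
Qed.

Lemma setl_ks a b c : (a <= b)%N -> (b <= c)%N -> (c <= n)%N ->
  setl (idx_itv n 1 a :|: idx_itv n b.+1 c) = ks a b c.
Proof.
move=> ab bc cn; apply: setlE; first exact: slist_ks.
by move=> i; rewrite !inE mem_cat !mem_iota !subnKC // !ltnS.
Qed.

(** The ratio P / Q of the relation P + Q = S at the octahedron (a, b, c), with indices from 0; S /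
    Q is then 1 + Y. *)
Definition yv (D : nat -> nat -> nat -> R) a b c : R :=
  (D a b c.+1 * D a.+1 b.+1 c) / (D a b.+1 c.+1 * D a.+1 b c).

Definition Fs (ls : nat -> nat -> nat -> seq nat) M (e : int) : R :=
  \sum_(a < n) \sum_(b < n) \sum_(c < n | (a < b < c)%N)
    ldilog (yv (fun a b c => DL n (ent M) (ls a b c)) a b c ^ e).

Lemma dilog_sumE (Y : nat -> nat -> nat -> 'M[R]_n -> R) M e :
  dilog_sum Y M e = \sum_(a < n) \sum_(b < n) \sum_(c < n | (a < b < c)%N)
    ldilog (Y a.+1 b.+1 c.+1 M ^ e).
Proof.
pose T a b c : R := if [&& 1 <= a, a < b & b < c]%N then ldilog (Y a b c M ^ e) else 0.
transitivity (\sum_(a < n.+1) \sum_(b < n.+1) \sum_(c < n.+1) T a b c).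
  rewrite pair_bigA pair_bigA /dilog_sum big_mkcond; apply: eq_bigr => -[[a b] c] _ /=.
  by rewrite inE.
(* The indices of [triples] start at 1 inside ['I_n.+1]: the terms with an index 0 are dropped and
   the rest is renumbered from 0. *)
rewrite big_ord_recl big1 ?add0r => [|b _]; last by rewrite big1.
apply: eq_bigr => a _; rewrite big_ord_recl big1 ?add0r => [|c _] //.
apply: eq_bigr => b _; rewrite big_ord_recl /T /= ?ltn0 ?andbF ?add0r [RHS]big_mkcond.
by apply: eq_bigr => c _.
Qed.

Lemma dilog_sum_YL M e : dilog_sum (@YL R n) M e = Fs gs M e.
Proof.
rewrite dilog_sumE; apply: eq_bigr => a _; apply: eq_bigr => b _.
apply: eq_bigr => c /andP[ab bc]; have cn := ltn_ord c.
suff -> : YL a.+1 b.+1 c.+1 M = yv (fun a b c => DL n (ent M) (gs a b c)) a b c by [].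
rewrite /YL !DeltaL_DL /yv !setl_gs //=; move: ab bc cn; clear; lia.
Qed.

Lemma dilog_sum_tYL M e : dilog_sum (@tYL R n) M e = Fs ks M e.
Proof.
rewrite dilog_sumE; apply: eq_bigr => a _; apply: eq_bigr => b _.
apply: eq_bigr => c /andP[ab bc]; have cn := ltn_ord c.
suff -> : tYL a.+1 b.+1 c.+1 M = yv (fun a b c => DL n (ent M) (ks a b c)) a b c by [].
rewrite /tYL !DeltaL_DL /yv !setl_ks //=; try by move: ab bc cn; clear; lia.
by congr (_ / _); exact: mulrC.
Qed.

Lemma sum_rev3 (T : nat -> nat -> nat -> R) :
  \sum_(a < n) \sum_(b < n) \sum_(c < n | (a < b < c)%N)
     T (n.-1 - c)%N (n.-1 - b)%N (n.-1 - a)%N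
  = \sum_(a < n) \sum_(b < n) \sum_(c < n | (a < b < c)%N) T a b c.
Proof.
have rev1 (f : nat -> R) : \sum_(i < n) f i = \sum_(i < n) f (n.-1 - i)%N.
  rewrite (reindex_inj rev_ord_inj); apply: eq_bigr => i _ /=.
  by congr (f _); have := ltn_ord i; move: (val i) => j; clear; lia.
pose S a b c := if (a < b < c)%N then T a b c else 0.
transitivity (\sum_(a < n) \sum_(b < n) \sum_(c < n) S a b c); last first.
  by apply: eq_bigr => a _; apply: eq_bigr => b _; rewrite [RHS]big_mkcond.
rewrite (rev1 (fun a => \sum_(b < n) \sum_(c < n) S a b c)).
under [RHS]eq_bigr => a _.
  rewrite (rev1 (fun b => \sum_(c < n) S (n.-1 - a)%N b c)).
  under eq_bigr => b _ do rewrite (rev1 (S (n.-1 - a)%N (n.-1 - b)%N)).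
  rewrite exchange_big; over.
rewrite [RHS]exchange_big; apply: eq_bigr => a _; rewrite [RHS]exchange_big.
apply: eq_bigr => b _; rewrite big_mkcond; apply: eq_bigr => c _.
rewrite /S; suff -> : (n.-1 - c < n.-1 - b < n.-1 - a)%N = (a < b < c)%N by [].
move: (ltn_ord a) (ltn_ord b) (ltn_ord c).
by move: (val a) (val b) (val c) => {}a {}b {}c; clear; lia.
Qed.

Lemma dilog_sum_tYU M e : dilog_sum (@tYU R n) M e = Fs gs (taumx M) e.
Proof.
rewrite dilog_sumE /Fs -(sum_rev3 (fun a b c => ldilog (yv _ a b c ^ e))).
apply: eq_bigr => a _; apply: eq_bigr => b _.
apply: eq_bigr => c /andP[ab bc]; have cn := ltn_ord c.
suff -> : tYU a.+1 b.+1 c.+1 M = yv (fun a b c => DL n (ent (taumx M)) (gs a b c))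
  (n.-1 - c) (n.-1 - b) (n.-1 - a) by [].
rewrite /tYU !DeltaU_DL /yv /= !setl_ks //=; try by move: ab bc cn; clear; lia.
rewrite !wrev_ks //; try by move: ab bc cn; clear; lia.
rewrite [X in X / _]mulrC [X in _ / X]mulrC; congr (_ * _ / (_ * _)); congr (DL _ _ (gs _ _ _)); move: ab bc cn; clear; lia.
Qed.

Lemma dilog_sum_YU M e : dilog_sum (@YU R n) M e = Fs ks (taumx M) e.
Proof.
rewrite dilog_sumE /Fs -(sum_rev3 (fun a b c => ldilog (yv _ a b c ^ e))).
apply: eq_bigr => a _; apply: eq_bigr => b _.
apply: eq_bigr => c /andP[ab bc]; have cn := ltn_ord c.
suff -> : YU a.+1 b.+1 c.+1 M = yv (fun a b c => DL n (ent (taumx M)) (ks a b c))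
  (n.-1 - c) (n.-1 - b) (n.-1 - a) by [].
rewrite /YU !DeltaU_DL /yv /= !setl_gs //=; try by move: ab bc cn; clear; lia.
rewrite !wrev_gs //; try by move: ab bc cn; clear; lia.
congr (_ * _ / (_ * _)); congr (DL _ _ (ks _ _ _)); move: ab bc cn; clear; lia.
Qed.

(** Reversing the rows sends the vertices of P for [gs] to those of Q for [ks], and conversely,
    whence the inverse. The factors of [factors_DL] depend only on sizes, and the two sizes in the
    numerator are those in the denominator. *)
Lemma yv_factors M A G a b c :
  Nplus M -> Nplus A -> Nplus G -> factors M A G -> (a < b)%N -> (b < c)%N -> (c < n)%N ->
  yv (fun a b c => DL n (ent A) (gs a b c)) a b c =
  (yv (fun a b c => DL n (ent M) (ks a b c)) (n.-1 - c) (n.-1 - b) (n.-1 - a))^-1.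
Proof.
move=> NM NA NG F ab bc cn.
have /NplusP[_ tM] := NM; have [NA' _] := NA; have [NG' _] := NG.
pose N k := DL n (ent M) (iota 0 k).
have N0 s : slist n s -> N (size s) != 0.
  by move=> sl; rewrite gt_eqF // DL_gt0 //; apply: slist_iota; exact: size_slist.
have E a' b' c' : (a' <= b')%N -> (b' <= c')%N -> (c' <= n)%N ->
   DL n (ent A) (gs a' b' c')
     = DL n (ent M) (ks (n - c')%N (n - b')%N (n - a')%N) / N (size (gs a' b' c')).
  move=> h1 h2 h3; have sl := slist_gs h1 h2 h3; rewrite -wrev_gs //.
  by rewrite (factors_DL NA' NG' F sl) mulfK // N0.
rewrite /yv !E; try lia.
have Dn0 a' b' c' : (a' <= b')%N -> (b' <= c')%N -> (c' <= n)%N ->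
   DL n (ent M) (ks (n - c')%N (n - b')%N (n - a')%N) != 0.
  by move=> h1 h2 h3; rewrite -wrev_gs // gt_eqF // DL_gt0 // slist_wrev // slist_gs.
have Nn0 a' b' c' : (a' <= b')%N -> (b' <= c')%N -> (c' <= n)%N -> N (size (gs a' b' c')) != 0.
  by move=> h1 h2 h3; exact/N0/slist_gs.
have e1 : ((n.-1 - c).+1 = n - c)%N by lia.
have e2 : ((n.-1 - b).+1 = n - b)%N by lia.
have e3 : ((n.-1 - a).+1 = n - a)%N by lia.
have f1 : (n.-1 - c = n - c.+1)%N by lia.
have f2 : (n.-1 - b = n - b.+1)%N by lia.
have f3 : (n.-1 - a = n - a.+1)%N by lia.
rewrite e1 e2 e3 f1 f2 f3.
have h1 : DL n (ent M) (ks (n - c.+1)%N (n - b)%N (n - a)%N) != 0 by apply: Dn0; lia.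
have h2 : DL n (ent M) (ks (n - c)%N (n - b.+1)%N (n - a.+1)%N) != 0 by apply: Dn0; lia.
have h3 : DL n (ent M) (ks (n - c.+1)%N (n - b.+1)%N (n - a)%N) != 0 by apply: Dn0; lia.
have h4 : DL n (ent M) (ks (n - c)%N (n - b)%N (n - a.+1)%N) != 0 by apply: Dn0; lia.
have h5 : N (size (gs a b c.+1)) != 0 by apply: Nn0; lia.
have h6 : N (size (gs a.+1 b.+1 c)) != 0 by apply: Nn0; lia.
have <- : size (gs a b c.+1) = size (gs a.+1 b c) by rewrite !size_gs; lia.
have <- : size (gs a.+1 b.+1 c) = size (gs a b.+1 c.+1) by rewrite !size_gs; lia.
move: (N _) (N _) h5 h6 => x y h5 h6.
move: (DL _ _ _) (DL _ _ _) (DL _ _ _) (DL _ _ _) h1 h2 h3 h4 => p q r s h1 h2 h3 h4.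
by field; rewrite ?h1 ?h2 ?h3 ?h4 ?h5 ?h6.
Qed.

Lemma Fs_gs_factors M A G e : Nplus M -> Nplus A -> Nplus G -> factors M A G ->
  Fs gs A e = Fs ks M (- e).
Proof.
move=> NM NA NG F; rewrite /Fs -[RHS](sum_rev3 (fun a b c => ldilog (yv _ a b c ^ (- e)))).
apply: eq_bigr => a _; apply: eq_bigr => b _; apply: eq_bigr => c /andP[ab bc].
by rewrite (yv_factors NM NA NG F ab bc (ltn_ord c)) exprz_inv.
Qed.

End FlagLists.

(** * Plucker relations between flag minors and the Vandermonde point *)

Section Split.
Variable n : nat.

(* The six lists are K + a, K + b + c, K + a + b, K + c, K + a + c and K + b. *)
Definition split6 (a b c : nat) (l1 l2 l3 l4 l5 l6 : seq nat) :=
  exists K1 K2 K3 K4, [/\ l1 = K1 ++ a :: K2 ++ K3 ++ K4, l2 = K1 ++ K2 ++ b :: K3 ++ c :: K4,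
    l3 = K1 ++ a :: K2 ++ b :: K3 ++ K4, l4 = K1 ++ K2 ++ K3 ++ c :: K4 &
    l5 = K1 ++ a :: K2 ++ K3 ++ c :: K4 /\ l6 = K1 ++ K2 ++ b :: K3 ++ K4].

Let iota_rcons a k l : iota a k ++ (a + k)%N :: l = iota a k.+1 ++ l.
Proof. by rewrite -addn1 iotaD -catA. Qed.

Lemma split_gs a b c : (a < b)%N -> (b < c)%N -> (c < n)%N ->
  split6 a b c (gs n a b c.+1) (gs n a.+1 b.+1 c) (gs n a b.+1 c.+1)
    (gs n a.+1 b c) (gs n a b c) (gs n a.+1 b.+1 c.+1).
Proof.
move=> ab bc cn; exists [::], (iota a.+1 (b - a.+1)), [::], (iota c.+1 (n - c.+1)).
have e1 : iota a (b - a) = a :: iota a.+1 (b - a.+1) by rewrite -(subnSK ab).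
have e2 : iota c (n - c) = c :: iota c.+1 (n - c.+1) by rewrite -(subnSK cn).
have e3 l : iota a.+1 (b.+1 - a.+1) ++ l = iota a.+1 (b - a.+1) ++ b :: l.
  rewrite (_ : b.+1 - a.+1 = (b - a.+1).+1)%N; last by lia.
  by rewrite -iota_rcons subnKC.
have e4 : iota a (b.+1 - a) = a :: iota a.+1 (b.+1 - a.+1) by rewrite -subnSK // ltnW.
by rewrite /gs e4 e1 e2 !cat_cons !e3.
Qed.

Lemma split_ks a b c : (a < b)%N -> (b < c)%N ->
  split6 a b c (ks a.+1 b.+1 c) (ks a b c.+1) (ks a.+1 b c)
    (ks a b.+1 c.+1) (ks a.+1 b.+1 c.+1) (ks a b c).
Proof.
move=> ab bc; exists (iota 0 a), [::], (iota b.+1 (c - b.+1)), [::].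
have e1 l : iota 0 a.+1 ++ l = iota 0 a ++ a :: l by rewrite -iota_rcons.
have e2 : iota b (c - b) = b :: iota b.+1 (c - b.+1) by rewrite -(subnSK bc).
have e3 : iota b.+1 (c.+1 - b.+1) = iota b.+1 (c - b.+1) ++ [:: c].
  rewrite (_ : c.+1 - b.+1 = (c - b.+1).+1)%N; last by lia.
  by rewrite -[LHS]cats0 -iota_rcons subnKC.
have e4 : iota b (c.+1 - b) = b :: iota b.+1 (c.+1 - b.+1) by rewrite -subnSK // ltnW.
by rewrite /ks !e1 e4 e2 e3 !cats0.
Qed.

Lemma size_split6 a b c l1 l2 l3 l4 l5 l6 : split6 a b c l1 l2 l3 l4 l5 l6 ->
  exists k, [/\ size l1 = k.+1, size l2 = k.+2, size l3 = k.+2, size l4 = k.+1 &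
    size l5 = k.+2 /\ size l6 = k.+1].
Proof.
case=> K1 [K2 [K3 [K4 [-> -> -> -> [-> ->]]]]].
exists (size (K1 ++ K2 ++ K3 ++ K4)); rewrite !(size_cat, size_cat _ (_ :: _)) /= !size_cat /= ?size_cat /=.
by split; try split; lia.
Qed.

Lemma plucker_split6 (R : realFieldType) (m : nat -> nat -> R) a b c l1 l2 l3 l4 l5 l6 :
  split6 a b c l1 l2 l3 l4 l5 l6 -> (size l2 <= n)%N ->
  DL n m l1 * DL n m l2 + DL n m l3 * DL n m l4 = DL n m l5 * DL n m l6.
Proof.
move=> h; have [k [s1 s2 s3 s4 [s5 s6]]] := size_split6 h.
rewrite /DL s1 s2 s3 s4 s5 s6 => kn.
case: h s1 => K1 [K2 [K3 [K4 [-> -> -> -> [-> ->]]]]] s1.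
have sK : size (K1 ++ K2 ++ K3 ++ K4) = k.
  by move: s1; rewrite !size_cat /= !size_cat; lia.
apply: plucker; rewrite ?sK ?size_iota //.
by move=> i; rewrite !mem_iota; lia.
Qed.

End Split.

Section Vandermonde.
Variable R : realFieldType.
Implicit Types s K : seq nat.

Definition vdm s : R := mn (fun i j => i%:R ^+ j) s (iota 0 (size s)).

Lemma vdmE s : vdm s = \prod_(i < size s) \prod_(j < size s | (i < j)%N)
  ((nth 0%N s j)%:R - (nth 0%N s i)%:R).
Proof.
rewrite /vdm mn_tr ?size_iota // /mn size_iota /dt.
have := det_Vandermonde (\row_(j < size s) ((nth 0%N s j)%:R : R)).
rewrite /Vandermonde => E; transitivity (\det (\matrix_(i < size s, j < size s)
   (\row_(j0 < size s) ((nth 0%N s j0)%:R : R)) 0 j ^+ i)).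
  by congr (\det _); apply/matrixP => i j; rewrite !mxE nth_iota.
by rewrite E; apply: eq_bigr => i _; apply: eq_bigr => j _; rewrite !mxE.
Qed.

Lemma vdm_gt0 s : sorted ltn s -> 0 < vdm s.
Proof.
move=> ss; rewrite vdmE; apply: prodr_gt0 => i _; apply: prodr_gt0 => j ij.
by rewrite subr_gt0 ltr_nat sorted_nth.
Qed.

Lemma vdm_cons a K : vdm (a :: K) = (\prod_(x <- K) (x%:R - a%:R)) * vdm K.
Proof.
rewrite !vdmE /= big_ord_recl /= big_mkcond big_ord_recl /= mul1r (big_nth 0%N) big_mkord.
congr (_ * _); apply: eq_bigr => i _; rewrite big_mkcond big_ord_recl /= mul1r.
by rewrite [RHS]big_mkcond; apply: eq_bigr => j _.
Qed.

(** By [vdm_cons] both products of Vandermonde determinants contain the same factors from K and from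
    K against a, b, c. They differ only by c - b, from the pair b, c in [l2], and b - a, from the
    pair a, b in [l3]. *)
Lemma vdm_split6 a b c l1 l2 l3 l4 l5 l6 : split6 a b c l1 l2 l3 l4 l5 l6 ->
  vdm l1 * vdm l2 * (b%:R - a%:R) = vdm l3 * vdm l4 * (c%:R - b%:R).
Proof.
move=> h; have [k [s1 s2 s3 s4 _]] := size_split6 h.
rewrite /vdm s1 s2 s3 s4.
case: h s1 => K1 [K2 [K3 [K4 [-> -> -> -> _]]]] s1.
have sK : size (K1 ++ K2 ++ K3 ++ K4) = k.
  by move: s1; rewrite !size_cat /= !size_cat; lia.
have [e _ [-> -> _]] := mn_sorted3 (fun i j => i%:R ^+ j : R) (iota 0 k.+2) (iota 0 k.+1) K1 K2 K3 K4 a b c.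
set K := K1 ++ _ in sK *.
have V1 x : mn (fun i j => i%:R ^+ j : R) (x :: K) (iota 0 k.+1) = vdm (x :: K).
  by rewrite /vdm /= sK.
have V2 x y : mn (fun i j => i%:R ^+ j : R) (x :: y :: K) (iota 0 k.+2) = vdm (x :: y :: K).
  by rewrite /vdm /= sK.
by rewrite !V1 !V2 !vdm_cons !big_cons; ring.
Qed.

End Vandermonde.

Section BasePoint.
Variables (R : realType) (n : nat).

(* The unipotent factor of a Vandermonde matrix. *)
Lemma vandermonde_Nplus : exists2 M : 'M[R]_n, Nplus M &
  exists2 w : nat -> R, (forall k, (k <= n)%N -> 0 < w k) &
    forall s, slist n s -> DL n (ent M) s = vdm R s * w (size s).
Proof.
(* Decreasing exponents make the last k columns the powers k-1, ..., 0, so every flag minor is a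
   Vandermonde determinant up to the sign of a reversal. *)
pose X : 'M[R]_n := \matrix_(i, j) (i%:R ^+ (n.-1 - j)).
have DX s : slist n s -> DL n (ent X) s = sgrev R (size s) * vdm R s.
  move=> sl; have sn := size_slist sl.
  rewrite /vdm mn_tr ?size_iota // -{1}[size s](size_iota 0) -mn_rev.
  rewrite -mn_tr ?size_rev ?size_iota //; apply: eq_dt => i j si sj.
  have i_n : (nth 0%N s i < n)%N by apply: (slist_lt sl); exact: mem_nth.
  rewrite nth_rev size_iota // !nth_iota //; last by lia.
  have jn : (n - size s + j < n)%N by lia.
  rewrite -[nth 0%N s i]/(val (Ordinal i_n)) -[(n - size s + j)%N]/(val (Ordinal jn)) entE mxE /=.
  by congr (_ ^+ _); lia.
have sg0 k : sgrev R k != 0.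
  apply/eqP => s0; have := sgrev_sqr R k.
  by rewrite s0 mul0r => /esym/eqP; rewrite oner_eq0.
have [j j_n|L [tL L0 NA]] := @UL_exists _ _ X.
  rewrite DX; last by apply: slist_iota; rewrite subnKC.
  by rewrite mulf_neq0 // gt_eqF // vdm_gt0 // iota_ltn_sorted.
pose v k : R := vdm R (iota (n - k) k).
have v0 k : 0 < v k by rewrite vdm_gt0 // iota_ltn_sorted.
have uXL : unitri n (mulm n (ent X) (ent L)).
  by apply: eq_unitri (proj1 (NgroupP _) NA) => i j i_n j_n; rewrite ent_mulmx.
have lL i j : (i < j)%N -> ent L i j = 0.
  move=> ij; rewrite /ent; case: insubP => // i' _ Ei; case: insubP => // j' _ Ej.
  by move/is_trig_mxP: tL => -> //; rewrite -[val i']/(\val i') Ei -[val j']/(\val j') Ej.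
have E s : slist n s -> DL n (ent (X *m L)) s = vdm R s * (v (size s))^-1.
  move=> sl; have sn := size_slist sl.
  have := DL_mulm_unitri_r uXL lL sl.
  rewrite !DX //; last by apply: slist_iota; rewrite subnK.
  rewrite size_iota -/(v _) (eq_DL (m' := ent (X *m L)) sl); last first.
    by move=> i j i_n j_n; rewrite ent_mulmx.
  rewrite mulrCA => /(mulfI (sg0 _)) ->.
  by rewrite mulfK // gt_eqF.
exists (X *m L); last by exists (fun k => (v k)^-1) => // k _; rewrite invr_gt0.
apply: Nplus_of_DL => // s sl; rewrite E // mulr_gt0 ?invr_gt0 // vdm_gt0 //.
by case/andP: sl.
Qed.

Lemma Fs_base : exists2 M : 'M[R]_n, Nplus M & Fs (@gs n) M 1 = Fs ks M 1.
Proof.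
have [M NM [w w0 DM]] := vandermonde_Nplus; exists M => //.
apply: eq_bigr => a _; apply: eq_bigr => b _; apply: eq_bigr => c /andP[ab bc].
have cn := ltn_ord c.
have Y l1 l2 l3 l4 l5 l6 : split6 a b c l1 l2 l3 l4 l5 l6 -> slist n l1 -> slist n l2 ->
    slist n l3 -> slist n l4 ->
    DL n (ent M) l1 * DL n (ent M) l2 / (DL n (ent M) l3 * DL n (ent M) l4) =
      (c%:R - b%:R) / (b%:R - a%:R).
  move=> h sl1 sl2 sl3 sl4; rewrite !DM //.
  have [k [z1 z2 z3 z4 _]] := size_split6 h.
  have kn : (k.+2 <= n)%N by rewrite -z2 size_slist.
  have w1 := w0 _ kn; have w2 := w0 _ (ltnW kn).
  have v3 : 0 < vdm R l3 by apply: vdm_gt0; case/andP: sl3.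
  have v4 : 0 < vdm R l4 by apply: vdm_gt0; case/andP: sl4.
  have ba : 0 < b%:R - a%:R :> R by rewrite subr_gt0 ltr_nat.
  rewrite z1 z2 z3 z4; apply/eqP.
  rewrite eqr_div ?(gt_eqF ba) //; last by rewrite gt_eqF // !mulr_gt0.
  apply/eqP.
  transitivity (vdm R l1 * vdm R l2 * (b%:R - a%:R) * (w k.+1 * w k.+2)); first by ring.
  by rewrite (vdm_split6 R h); ring.
suff -> : yv (fun a b c => DL n (ent M) (gs n a b c)) a b c =
    yv (fun a b c => DL n (ent M) (ks a b c)) a b c by [].
rewrite /yv (Y _ _ _ _ _ _ (split_gs ab bc cn)); try (apply: slist_gs; lia).
rewrite [X in _ = X / _]mulrC [X in _ = _ / X]mulrC.
by rewrite (Y _ _ _ _ _ _ (split_ks ab bc)) //; apply: slist_ks; lia.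
Qed.

End BasePoint.

(** * Differentiation along curves *)

Section Derivability.
Variable R : realType.
Implicit Types (f g : R -> R) (x : R).

Lemma derivable_bigsum (I : Type) (r : seq I) (f : I -> R -> R) x :
  (forall i, derivable (f i) x 1) -> derivable (fun s => \sum_(i <- r) f i s) x 1.
Proof.
move=> df; elim: r => [|i r IH].
  by under eq_fun do rewrite big_nil; exact: derivable_cst.
by under eq_fun do rewrite big_cons; exact: derivableD.
Qed.

Lemma derivable_bigprod (I : Type) (r : seq I) (f : I -> R -> R) x :
  (forall i, derivable (f i) x 1) -> derivable (fun s => \prod_(i <- r) f i s) x 1.
Proof.
move=> df; elim: r => [|i r IH].
  by under eq_fun do rewrite big_nil; exact: derivable_cst.
by under eq_fun do rewrite big_cons; exact: derivableM.
Qed.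

Lemma derivable_mn (m : R -> nat -> nat -> R) s t x :
  (forall i j, derivable (fun z => m z i j) x 1) -> derivable (fun z => mn (m z) s t) x 1.
Proof.
move=> dm; rewrite /mn /dt /determinant; apply: derivable_bigsum => p.
apply: derivableM; first exact: derivable_cst.
apply: derivable_bigprod => i; under eq_fun do rewrite mxE; exact: dm.
Qed.

Definition logd f x : R * R := (ln (f x), 'D_1 f x / f x).

(** Here log y = P - Q and log (1 + y) = S - Q, the latter by the relation, and likewise for the
    logarithmic derivatives. The derivative is thus a multiple of [br (S - Q) (P - Q)], which
    expands to the cyclic sum. *)
Lemma is_derive_ldilog_ratio (p1 p2 p3 p4 p5 p6 : R -> R) x :
  (forall p, p \in [:: p1; p2; p3; p4; p5; p6] -> derivable p x 1 /\ 0 < p x) ->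
  (forall z, p1 z * p2 z + p3 z * p4 z = p5 z * p6 z) ->
  let P := logd p1 x + logd p2 x in
  let Q := logd p3 x + logd p4 x in
  let S := logd p5 x + logd p6 x in
  is_derive x 1 (fun z => ldilog (p1 z * p2 z / (p3 z * p4 z)))
    (3 / pi ^+ 2 * (br P Q + br Q S + br S P)).
Proof.
move=> dp E P Q S.
have [d1 h1] := dp p1 ltac:(by rewrite !inE eqxx).
have [d2 h2] := dp p2 ltac:(by rewrite !inE eqxx ?orbT).
have [d3 h3] := dp p3 ltac:(by rewrite !inE eqxx ?orbT).
have [d4 h4] := dp p4 ltac:(by rewrite !inE eqxx ?orbT).
have [d5 h5] := dp p5 ltac:(by rewrite !inE eqxx ?orbT).
have [d6 h6] := dp p6 ltac:(by rewrite !inE eqxx ?orbT).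
have D1 := @derivableP _ _ _ _ _ _ d1; have D2 := @derivableP _ _ _ _ _ _ d2.
have D3 := @derivableP _ _ _ _ _ _ d3; have D4 := @derivableP _ _ _ _ _ _ d4.
have D5 := @derivableP _ _ _ _ _ _ d5; have D6 := @derivableP _ _ _ _ _ _ d6.
move: (D1) (D2) (D3) (D4) (D5) (D6).
rewrite /P /Q /S /logd /br /=.
set b1 := 'D_1 p1 x; set b2 := 'D_1 p2 x; set b3 := 'D_1 p3 x.
set b4 := 'D_1 p4 x; set b5 := 'D_1 p5 x; set b6 := 'D_1 p6 x => E1 E2 E3 E4 E5 E6.
pose D0 := p3 x * p4 x; pose N := p1 x * p2 x; pose S0 := p5 x * p6 x.
pose D' := b3 * p4 x + p3 x * b4; pose N' := b1 * p2 x + p1 x * b2.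
pose S' := b5 * p6 x + p5 x * b6.
have D0gt : 0 < D0 by apply: mulr_gt0.
have Ngt : 0 < N by apply: mulr_gt0.
have Sgt : 0 < S0 by apply: mulr_gt0.
have NDS : N + D0 = S0 by apply: E.
have NDS' : N' + D' = S'.
  have h12 : is_derive x 1 (fun z => p1 z * p2 z + p3 z * p4 z) (N' + D').
    by apply: is_derive1_eq; rewrite /GRing.scale /= /N' /D'; ring.
  have h56 : is_derive x 1 (fun z => p1 z * p2 z + p3 z * p4 z) S'.
    rewrite (_ : (fun z => _) = (fun z => p5 z * p6 z)); last exact/funext.
    by apply: is_derive1_eq; rewrite /GRing.scale /= /S'; ring.
  by case: h12 => _ <-; case: h56 => _ <-.
have dV : is_derive x 1 (fun z => (p3 z * p4 z)^-1) (- D0 ^- 2 * D').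
  apply: is_derive1_eq; first by apply: is_deriveV; rewrite gt_eqF.
  by rewrite /GRing.scale /= /D' /D0; ring.
have dY : is_derive x 1 (fun z => p1 z * p2 z / (p3 z * p4 z)) ((N' * D0 - N * D') / D0 ^+ 2).
  apply: is_derive1_eq; rewrite /GRing.scale /= -/N -/D0 /N'.
  by field; rewrite gt_eqF.
have Ygt : 0 < N / D0 by apply: divr_gt0.
have dl : is_derive (p1 x * p2 x / (p3 x * p4 x)) 1 (@ldilog R) _ := is_derive_ldilog Ygt.
have dC := @is_derive1_comp R (@ldilog R) (fun z => p1 z * p2 z / (p3 z * p4 z)) x _ _ dl dY.
apply: (is_derive1_eq dC).
have -> : 1 + N / D0 = S0 / D0 by rewrite -NDS; field; rewrite gt_eqF.
rewrite !ln_div ?posrE // /S0 /N /D0 !lnM ?posrE // -/S0 -/N -/D0.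
have q1 : (N' * D0 - N * D') / D0 ^+ 2 / (N / D0) = N' / N - D' / D0.
  by field; rewrite !gt_eqF.
have q2 : (N' * D0 - N * D') / D0 ^+ 2 / (S0 / D0) = S' / S0 - D' / D0.
  have -> : N' = S' - D' by rewrite -NDS' addrK.
  have -> : N = S0 - D0 by rewrite -NDS addrK.
  by field; rewrite !gt_eqF.
set Y' := (N' * D0 - N * D') / D0 ^+ 2 in q1 q2 *.
rewrite -[LHS]mulrA; congr (_ * _).
set l1 := ln (p1 x); set l2 := ln (p2 x); set l3 := ln (p3 x).
set l4 := ln (p4 x); set l5 := ln (p5 x); set l6 := ln (p6 x).
transitivity ((l5 + l6 - (l3 + l4)) * (Y' / (N / D0))
   - (l1 + l2 - (l3 + l4)) * (Y' / (S0 / D0))); first by ring.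
rewrite q1 q2 /N' /N /D' /D0 /S' /S0.
by field; rewrite !gt_eqF.
Qed.

End Derivability.

(** * The derivatives of the sums as boundary terms *)

Section Curve.
Variables (R : realType) (n : nat).
Implicit Types (Mx : R -> 'M[R]_n) (l : seq nat) (x : R)
  (ls : nat -> nat -> nat -> seq nat).

Lemma is_derive_bigsum (I : Type) (r : seq I) (P : pred I) (f : I -> R -> R) (d : I -> R) x :
  (forall i, P i -> is_derive x 1 (f i) (d i)) ->
  is_derive x 1 (fun z => \sum_(i <- r | P i) f i z) (\sum_(i <- r | P i) d i).
Proof.
move=> df; elim: r => [|i r IH].
  by under eq_fun do rewrite big_nil; rewrite big_nil; exact: is_derive_cst.
under eq_fun do rewrite big_cons; rewrite big_cons; case: ifP => // Pi.
by have := df i Pi => ?; exact: is_deriveD.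
Qed.

Definition dl Mx l x : R := DL n (ent (Mx x)) l.

Definition derivable_curve Mx := forall i j x, derivable (fun z => Mx z i j) x 1.

Lemma derivable_dl Mx l x : derivable_curve Mx -> derivable (dl Mx l) x 1.
Proof.
move=> dM; apply: derivable_mn => i j; rewrite /ent.
case: insubP => [i' _ _|_]; last exact: derivable_cst.
by case: insubP => [j' _ _|_]; [exact: dM | exact: derivable_cst].
Qed.

(** The value 0 off a <= b <= c replaces the meaningless rows that truncated differences would give
    there, as [sum_oct] requires. *)
Definition phi Mx ls x a b c : R * R :=
  if (a <= b <= c)%N then logd (dl Mx (ls a b c)) x else 0.

Lemma logd1 (f : R -> R) x : (forall z, f z = 1) -> logd f x = 0.
Proof.
move=> f1; rewrite /logd (_ : f = cst 1) ?ln1; last exact/funext.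
by rewrite derive_cst mul0r.
Qed.

Lemma dl_last Mx a x : (forall z, Ngroup (Mx z)) -> (a <= n)%N -> dl Mx (iota a (n - a)) x = 1.
Proof.
move=> uM an; rewrite /dl -{1}[a](subKn an) DL_last ?leq_subr //.
exact/NgroupP.
Qed.

(** The octahedron (Hirota) recurrence. It holds for every [m], so it can be differentiated along a
    curve. *)
Definition hirota ls := (forall a b c, (a <= b)%N -> (b <= c)%N -> (c <= n)%N -> slist n (ls a b c))
  /\ forall (m : nat -> nat -> R) a b c, (a < b)%N -> (b < c)%N -> (c < n)%N ->
    DL n m (ls a b c.+1) * DL n m (ls a.+1 b.+1 c) + DL n m (ls a b.+1 c.+1) * DL n m (ls a.+1 b c)
    = DL n m (ls a b c) * DL n m (ls a.+1 b.+1 c.+1).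

Lemma hirota_gs : hirota (gs n).
Proof.
split=> [a b c ab bc cn|m a b c ab bc cn]; first exact: slist_gs.
by apply: plucker_split6 (split_gs ab bc cn) _; rewrite size_gs; lia.
Qed.

Lemma hirota_ks : hirota ks.
Proof.
split=> [a b c ab bc cn|m a b c ab bc cn]; first exact: slist_ks.
rewrite [X in X + _]mulrC [X in _ + X]mulrC [RHS]mulrC.
by apply: plucker_split6 (split_ks ab bc) _; rewrite size_ks; lia.
Qed.

Lemma is_derive_Fs Mx ls x : derivable_curve Mx -> Nplus (Mx x) -> hirota ls ->
  is_derive x 1 (fun z => Fs ls (Mx z) 1) (3 / pi ^+ 2 *
    \sum_(a < n) \sum_(b < n) \sum_(c < n | (a < b < c)%N) oct (phi Mx ls x) a b c).
Proof.
move=> dM /NplusP[_ tM] [sl rel]; rewrite /Fs mulr_sumr.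
apply: is_derive_bigsum => a _; rewrite mulr_sumr.
apply: is_derive_bigsum => b _; rewrite mulr_sumr.
apply: is_derive_bigsum => c /andP[ab bc]; have cn := ltn_ord c.
under eq_fun do rewrite expr1z.
have E a' b' c' : (a' <= b')%N -> (b' <= c')%N ->
    phi Mx ls x a' b' c' = logd (dl Mx (ls a' b' c')) x.
  by move=> h1 h2; rewrite /phi h1 h2.
rewrite /oct !E; try by move: ab bc cn; clear; lia.
apply: (@is_derive_ldilog_ratio R (dl Mx (ls a b c.+1)) (dl Mx (ls a.+1 b.+1 c))
   (dl Mx (ls a b.+1 c.+1)) (dl Mx (ls a.+1 b c)) (dl Mx (ls a b c)) (dl Mx (ls a.+1 b.+1 c.+1))).
  have dpos a' b' c' : (a' <= b')%N -> (b' <= c')%N -> (c' <= n)%N ->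
      derivable (dl Mx (ls a' b' c')) x 1 /\ 0 < dl Mx (ls a' b' c') x.
    by move=> h1 h2 h3; split; [exact: derivable_dl | apply: DL_gt0 => //; exact: sl].
  move=> p; rewrite !inE => /orP[/eqP->|/orP[/eqP->|/orP[/eqP->|/orP[/eqP->|/orP[/eqP->|/eqP->]]]]];
  by apply: dpos; move: ab bc cn; clear; lia.
by move=> z; apply: rel.
Qed.

Section Sums.
Variables (Mx : R -> 'M[R]_n) (x : R).
Hypothesis uM : forall z, Ngroup (Mx z).

Lemma gs_last a c : (a <= c)%N -> (c <= n)%N -> gs n a c c = iota a (n - a).
Proof.
move=> ac cn; rewrite /gs -{2}(subnKC ac) -iotaD; congr (iota _ _).
by move: ac cn; clear; lia.
Qed.

(** The rows are the last ones, where the flag minor of a unipotent matrix is identically 1; its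
    logarithm and its derivative vanish. *)
Lemma phi_gs_last a c : (c <= n)%N -> phi Mx (gs n) x a c c = 0.
Proof.
rewrite /phi leqnn andbT; case: ifP => // ac cn.
apply: logd1 => z; rewrite gs_last // dl_last //.
exact: leq_trans cn.
Qed.

Lemma sum_oct_gs :
  \sum_(a < n) \sum_(b < n) \sum_(c < n | (a < b < c)%N) oct (phi Mx (gs n) x) a b c =
  tri n (phi Mx (gs n) x 0%N) + tri n (fun a b => phi Mx (gs n) x a b n)
  - \sum_(b < n) br (phi Mx (gs n) x 0%N b n) (phi Mx (gs n) x 0%N b.+1 n).
Proof.
rewrite sum_oct_lt.
- rewrite [X in _ - X]big1 ?subr0 // => a _; rewrite phi_gs_last ?br0l //.
  by have := ltn_ord a; exact: ltnW.
- by move=> a b c /negPf h; rewrite /phi h.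
- move=> a c ac cn; rewrite /phi !leqnn ac (ltnW ac) /=.
  by rewrite /gs !subnn.
- by move=> a c ac cn; rewrite !phi_gs_last // ltnW.
Qed.

(** The two faces trade places: [ks 0 b c] is the interval [b, c) of [gs b c n], and [ks a b n] is
    [gs 0 a b]. On the common edge the rows are now the last ones, so that term vanishes. The
    diagonal rows [ks a a a] are [0, a), that is [gs 0 a n], so the diagonal sum supplies the edge
    sum of [sum_oct_gs]. *)
Lemma sum_oct_ks :
  \sum_(a < n) \sum_(b < n) \sum_(c < n | (a < b < c)%N) oct (phi Mx ks x) a b c =
  tri n (phi Mx (gs n) x 0%N) + tri n (fun a b => phi Mx (gs n) x a b n)
  - \sum_(b < n) br (phi Mx (gs n) x 0%N b n) (phi Mx (gs n) x 0%N b.+1 n).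
Proof.
have kX b c : (c <= n)%N -> phi Mx ks x 0%N b c = phi Mx (gs n) x b c n.
  move=> cn; rewrite /phi leq0n cn andbT /=; case: ifP => // bc.
  by rewrite /ks /gs subnn /= cats0.
have kZ a b : (b <= n)%N -> phi Mx ks x a b n = phi Mx (gs n) x 0%N a b.
  by move=> bn; rewrite /phi leq0n bn andbT /= /ks /gs subn0.
rewrite sum_oct_lt.
- rewrite [X in _ - X - _]big1 ?subr0; last first.
    by move=> b _; rewrite kX // phi_gs_last ?br0l // ltnW.
  rewrite [X in X - _ = _]addrC; congr (_ + _ - _).
  + by apply: eq_tri => a b an bn; rewrite kZ.
  + by apply: eq_tri => a b an bn; rewrite kX.
  + apply: eq_bigr => b _; have bn := ltn_ord b.
    by rewrite -!kZ ?leqnn // /phi !leqnn /ks !subnn /= !cats0 bn ltnW.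
- by move=> a b c /negPf h; rewrite /phi h.
- move=> a c ac cn; rewrite /phi !leqnn ac (ltnW ac) /= /ks.
  by rewrite -!iotaD !subnKC // ltnW.
- move=> a c ac cn; rewrite /phi !leqnn ac (leqW ac) /= /ks.
  by rewrite !subnn.
Qed.

End Sums.

(** Reflection turns the left side into the minor with the first c - b rows and the columns [n - c,
    n - b). Adjoining the rows and columns [n - b, n) multiplies it by a unitriangular block of
    determinant 1 and makes it a flag minor. *)
Lemma tau_interval (m : nat -> nat -> R) b c : unitri n m -> (b <= c)%N -> (c <= n)%N ->
  DL n (tau n m) (iota b (c - b)) = DL n m (gs n 0 (c - b) (n - b)).
Proof.
move=> um bc cn; have bn := leq_trans bc cn.
have e : (n - b + b = n)%N by rewrite subnK.
rewrite /DL mn_tau ?size_iota // wrev_last; last by rewrite (leq_trans (leq_subr _ _)).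
rewrite wrev_iota ?subnKC // size_gs subn0 subKn // subnK //.
rewrite /gs subn0 subKn //.
have -> : iota (n - c) c = iota (n - c) (c - b) ++ iota (n - b) b.
  rewrite -{2}(subnK bc) iotaD; congr (_ ++ iota _ _).
  by move: bc cn; clear; lia.
rewrite mn_cat ?size_iota //; last first.
  move=> i j; rewrite !mem_iota => /andP[hi i_n] /andP[_ hj]; apply: um.1; last by rewrite -e.
  by apply: leq_trans hi; move: hj bc cn; clear; lia.
by rewrite [X in _ = _ * X](mn_diag um) ?mulr1 //; apply: slist_iota; rewrite e.
Qed.

Section Reflection.
Variables (Mx : R -> 'M[R]_n) (x : R).
Hypothesis uM : forall z, Ngroup (Mx z).

Let tMx z := taumx (Mx z).
Let utM z : Ngroup (tMx z). Proof. exact: Ngroup_tau. Qed.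

Lemma phi_tau b c : (b <= c <= n)%N ->
  phi tMx (gs n) x b c n = phi Mx (gs n) x 0%N (c - b)%N (n - b)%N.
Proof.
move=> /andP[bc cn]; rewrite /phi bc cn leq0n leq_sub2r //=.
congr logd; apply/funext => z; rewrite /dl.
have -> : gs n b c n = iota b (c - b) by rewrite /gs subnn cats0.
have uz : unitri n (ent (Mx z)) by apply/NgroupP.
rewrite -(tau_interval uz) //; apply: eq_DL => [|i j i_n j_n]; last by rewrite ent_taumx.
by apply: slist_iota; rewrite subnKC.
Qed.

Lemma tri_tau : tri n (fun a b => phi tMx (gs n) x a b n) = tri n (phi Mx (gs n) x 0%N).
Proof.
apply: tri_rot => [a b ba|a b ba|a b abn]; last exact: phi_tau.
  by rewrite /phi leqNgt ba.
by rewrite /phi leq0n /= leqNgt ba.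
Qed.

End Reflection.

(** [tri_tau], used for the curve and for its reflection, exchanges the two faces; the common edge
    is fixed, by [phi_tau] with b = 0. *)
Lemma sum_oct_tau Mx x : (forall z, Ngroup (Mx z)) ->
  \sum_(a < n) \sum_(b < n) \sum_(c < n | (a < b < c)%N)
     oct (phi (fun z => taumx (Mx z)) (gs n) x) a b c =
  \sum_(a < n) \sum_(b < n) \sum_(c < n | (a < b < c)%N) oct (phi Mx (gs n) x) a b c.
Proof.
move=> uM; have utM z : Ngroup (taumx (Mx z)) by exact: Ngroup_tau.
rewrite !sum_oct_gs // tri_tau // -(tri_tau x utM) /=.
rewrite (_ : (fun z => taumx (taumx (Mx z))) = Mx); last by apply/funext => z; rewrite taumxK.
rewrite [X in X - _ = _]addrC; congr (_ - _); apply: eq_bigr => b _.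
have bn := ltn_ord b; rewrite !phi_tau // ?subn0 ?leq0n ?(ltnW bn) //.
Qed.

End Curve.

(** * Paths in the totally positive part *)

Section Path.
Variables (R : realType) (n : nat).
Implicit Types (M N : 'M[R]_n) (z : R).

Definition dilate z M : 'M[R]_n := \matrix_(i, j) (z ^+ (j - i) * M i j).

Lemma ent_dilate z M i j : (i < n)%N -> (j < n)%N ->
  ent (dilate z M) i j = z ^+ (j - i) * ent M i j.
Proof.
move=> i_n j_n; rewrite -[i in LHS]/(val (Ordinal i_n)) -[j in LHS]/(val (Ordinal j_n)) entE mxE.
by rewrite -entE.
Qed.

Lemma Ngroup_dilate z M : Ngroup M -> Ngroup (dilate z M).
Proof.
move=> /NgroupP uM; apply/NgroupP; apply: eq_unitri (unitri_scale z uM) => i j i_n j_n.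
by rewrite ent_dilate.
Qed.

Lemma Nplus_dilate z M : 0 < z -> Nplus M -> Nplus (dilate z M).
Proof.
move=> z0 /NplusP[uM tM]; apply/NplusP; split.
  by apply/NgroupP/Ngroup_dilate/NgroupP.
by apply: eq_tp (tp_scale z0 uM.1 tM) => i j i_n j_n; rewrite ent_dilate.
Qed.

Lemma dilate0 M : Ngroup M -> dilate 0 M = 1%:M.
Proof.
move=> /NgroupP[uM M1]; apply/matrixP => i j; rewrite !mxE expr0n subn_eq0 -entE.
have [ij|ji|/val_inj ->] := ltngtP (val i) (val j).
- by rewrite mul0r -val_eqE ltn_eqF.
- by rewrite uM // mulr0 -val_eqE gtn_eqF.
- by rewrite M1 ?eqxx ?mulr1.
Qed.

Lemma dilate1 M : dilate 1 M = M.
Proof. by apply/matrixP => i j; rewrite mxE expr1n mul1r. Qed.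

Lemma Ngroup_mulmx M N : Ngroup M -> Ngroup N -> Ngroup (M *m N).
Proof.
move=> /NgroupP uM /NgroupP uN; apply/NgroupP; apply: eq_unitri (unitri_mulm uM uN) => i j i_n j_n.
by rewrite ent_mulmx.
Qed.

Lemma Nplus_mulmx M N : Nplus M -> Nplus N -> Nplus (M *m N).
Proof.
move=> /NplusP[uM tM] /NplusP[uN tN]; apply/NplusP; split.
  by apply/NgroupP/Ngroup_mulmx; apply/NgroupP.
by apply: eq_tp (tp_mulm uM uN tM tN) => i j i_n j_n; rewrite ent_mulmx.
Qed.

(** The dilation by 0 is the identity, so the path runs from M at z = 0 to N at z = 1. It is
    polynomial in z and unipotent for every real z, so two-sided derivatives make sense at the ends.
    Inside (0, 1) both factors lie in $N_n^+$; at the ends one factor is the identity, and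
    [Nplus_path] treats these points apart. *)
Definition path_mx M N z : 'M[R]_n := dilate (1 - z) M *m dilate z N.

Lemma derivable_pow (f : R -> R) p c x : derivable f x 1 ->
  derivable (fun z => f z ^+ p * c) x 1.
Proof.
move=> df; have dX : derivable (fun z => f z ^+ p) x 1.
  elim: p => [|p IH]; first exact: derivable_cst.
  rewrite (_ : (fun z => _) = f * (fun z => f z ^+ p)); first exact: derivableM.
  by apply/funext => z; rewrite exprS.
rewrite (_ : (fun z => _) = (fun z => f z ^+ p) * cst c); last exact/funext.
by apply: derivableM dX _; exact: derivable_cst.
Qed.

Lemma derivable_path_mx M N : derivable_curve (path_mx M N).
Proof.
move=> i j x; rewrite (_ : (fun z => _) = fun z =>
  \sum_(k < n) ((1 - z) ^+ (k - i) * M i k) * (z ^+ (j - k) * N k j)); last first.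
  by apply/funext => z; rewrite mxE; apply: eq_bigr => k _; rewrite !mxE.
apply: derivable_bigsum => k.
pose f (z : R) : R := (1 - z) ^+ (k - i) * M i k; pose g (z : R) : R := z ^+ (j - k) * N k j.
rewrite -[X in derivable X]/(f * g); apply: derivableM.
  apply: (@derivable_pow (fun z => 1 - z)).
  by apply: derivableB; [exact: derivable_cst | exact: derivable_id].
by apply: (@derivable_pow id); exact: derivable_id.
Qed.

Lemma Ngroup_path M N z : Ngroup M -> Ngroup N -> Ngroup (path_mx M N z).
Proof. by move=> NM NN; apply: Ngroup_mulmx; exact: Ngroup_dilate. Qed.

Lemma path_mx0 M N : Ngroup N -> path_mx M N 0 = M.
Proof. by move=> NN; rewrite /path_mx subr0 dilate1 dilate0 // mulmx1. Qed.

Lemma path_mx1 M N : Ngroup M -> path_mx M N 1 = N.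
Proof. by move=> NM; rewrite /path_mx subrr dilate1 dilate0 // mul1mx. Qed.

Lemma Nplus_path M N z : Nplus M -> Nplus N -> 0 <= z <= 1 -> Nplus (path_mx M N z).
Proof.
move=> NM NN /andP[]; rewrite le_eqVlt => /predU1P[<- _|z0].
  by rewrite path_mx0 //; case: NN.
rewrite le_eqVlt => /predU1P[->|z1]; first by rewrite path_mx1 //; case: NM.
by apply: Nplus_mulmx; apply: Nplus_dilate; rewrite ?subr_gt0.
Qed.

Lemma path_constant (F : 'M[R]_n -> R) M N : Nplus M -> Nplus N ->
  (forall z, 0 <= z <= 1 -> is_derive z 1 (fun z => F (path_mx M N z)) 0) -> F M = F N.
Proof.
move=> NM NN dF; rewrite -[in LHS](@path_mx0 M N); last by case: NN.
rewrite -[in RHS](@path_mx1 M N); last by case: NM.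
by apply: (@eq_of_derive0 _ (fun z => F (path_mx M N z)) 0 1) => // z; rewrite in_itv; exact: dF.
Qed.

End Path.

(** * Equality of the four sums and the action of the permutations *)

Section Sums.
Variables (R : realType) (n : nat).
Implicit Types (M N A : 'M[R]_n) (e : int).

Lemma Fs_diff_cst M N : Nplus M -> Nplus N ->
  Fs (gs n) M 1 - Fs ks M 1 = Fs (gs n) N 1 - Fs ks N 1.
Proof.
move=> NM NN; apply: (path_constant (F := fun M => Fs (gs n) M 1 - Fs ks M 1) NM NN) => z z01.
have Np := Nplus_path NM NN z01; have cp : derivable_curve (path_mx M N) := @derivable_path_mx R n M N.
have [NM' _] := NM; have [NN' _] := NN.
have up (z' : R) : Ngroup (path_mx M N z') by exact: Ngroup_path.
have d1 := is_derive_Fs cp Np (hirota_gs R n).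
have d2 := is_derive_Fs cp Np (hirota_ks R n).
apply: (is_derive1_eq (is_deriveB d1 d2)).
by rewrite sum_oct_gs // sum_oct_ks // subrr.
Qed.

Lemma Fs_tau_diff_cst M N : Nplus M -> Nplus N ->
  Fs (gs n) M 1 - Fs (gs n) (taumx M) 1 = Fs (gs n) N 1 - Fs (gs n) (taumx N) 1.
Proof.
move=> NM NN.
apply: (path_constant (F := fun M => Fs (gs n) M 1 - Fs (gs n) (taumx M) 1) NM NN) => z z01.
have Np := Nplus_path NM NN z01; have cp : derivable_curve (path_mx M N) := @derivable_path_mx R n M N.
have [NM' _] := NM; have [NN' _] := NN.
have up (z' : R) : Ngroup (path_mx M N z') by exact: Ngroup_path.
have d1 := is_derive_Fs cp Np (hirota_gs R n).
have tcp : derivable_curve (fun z => taumx (path_mx M N z)).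
  move=> i j x; under eq_fun do rewrite mul_antidiagE antidiag_mulE mxE; exact: cp.
have d2 := is_derive_Fs tcp (Nplus_tau Np) (hirota_gs R n).
apply: (is_derive1_eq (is_deriveB d1 d2)).
by rewrite sum_oct_tau // subrr.
Qed.

Lemma Fs_gs_ks1 M : Nplus M -> Fs (gs n) M 1 = Fs ks M 1.
Proof.
move=> NM; have [N NN E] := @Fs_base R n.
by apply/eqP; rewrite -subr_eq0 (Fs_diff_cst NM NN) E subrr.
Qed.

Lemma Fs_gs_tau1 M : Nplus M -> Fs (gs n) M 1 = Fs (gs n) (taumx M) 1.
Proof.
move=> NM; have := Fs_tau_diff_cst NM (Nplus_tau NM); rewrite taumxK; lra.
Qed.

(** Termwise [ldilogV]. The resulting constant depends on n alone, so an equality between sums with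
    exponent 1 passes to exponent -1. *)
Lemma Fs_opp M ls : Nplus M -> hirota R n ls -> Fs ls M (-1) =
  \sum_(a < n) \sum_(b < n) \sum_(c < n | (a < b < c)%N) (ldilog 1 + ldilog 1) - Fs ls M 1.
Proof.
move=> /NplusP[_ tM] [sl _]; rewrite /Fs -sumrB; apply: eq_bigr => a _; rewrite -sumrB.
apply: eq_bigr => b _; rewrite -sumrB; apply: eq_bigr => c /andP[ab bc].
have cn := ltn_ord c; rewrite expr1z exprN1; set y := yv _ _ _ _.
have y0 : 0 < y.
  by rewrite /y /yv divr_gt0 // mulr_gt0 // DL_gt0 //; apply: sl; move: ab bc cn; clear; lia.
by rewrite -(ldilogV y0) addrK.
Qed.

Definition unit_exp e := e = 1 \/ e = -1.

Lemma unit_expN e : unit_exp e -> unit_exp (- e).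
Proof. by case=> ->; [right|left]; rewrite ?opprK. Qed.

Lemma Fs_gs_ks M e : Nplus M -> unit_exp e -> Fs (gs n) M e = Fs ks M e.
Proof.
move=> NM [->|->]; first exact: Fs_gs_ks1.
by rewrite !Fs_opp ?Fs_gs_ks1 //; [exact: hirota_ks | exact: hirota_gs].
Qed.

Lemma Fs_gs_tau M e : Nplus M -> unit_exp e -> Fs (gs n) M e = Fs (gs n) (taumx M) e.
Proof.
move=> NM [->|->]; first exact: Fs_gs_tau1.
have NtM := Nplus_tau NM.
by rewrite !Fs_opp ?(Fs_gs_tau1 NM) //; exact: hirota_gs.
Qed.

Lemma Fs_prime1 M e : Nplus M -> unit_exp e -> Fs (gs n) (prime1 M) e = Fs (gs n) M (- e).
Proof.
move=> NM ue; have [N1 N2 F] := primes_factor NM.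
by rewrite (Fs_gs_factors e NM N1 N2 F) Fs_gs_ks //; exact: unit_expN.
Qed.

(** After reflection [prime2 M] is the first factor of [taumx M], so the argument for [prime1]
    applies there; two uses of [Fs_gs_tau] remove the reflections. *)
Lemma Fs_prime2 M e : Nplus M -> unit_exp e -> Fs (gs n) (prime2 M) e = Fs (gs n) M (- e).
Proof.
move=> NM ue; have [N1 N2 F] := primes_factor NM.
have ue' := unit_expN ue; have NtM := Nplus_tau NM.
rewrite (Fs_gs_tau N2 ue).
rewrite (Fs_gs_factors e NtM (Nplus_tau N2) (Nplus_tau N1) (factors_tau F)).
by rewrite -(Fs_gs_ks NtM ue') -Fs_gs_tau.
Qed.

Lemma sgn_sigma : sgn sigma1 = -1 /\ sgn sigma2 = -1.
Proof.
have s1 (a b : nat) : (a < 3)%N -> (b < 3)%N -> a != b ->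
    sgn (tperm (inord a : 'I_3) (inord b)) = -1.
  by move=> a3 b3 ab; rewrite /sgn odd_tperm -val_eqE /= !inordK // ab.
by split; apply: s1.
Qed.

(** Each prime reverses the exponent and each generator reverses the sign. In every case of
    [s_image] there are as many primes as generators, so the reversals cancel; this treats both
    values for the longest element alike. *)
Lemma Fs_s_image M s A : Nplus M -> s_image M s A ->
  [/\ Nplus A, unit_exp (sgn s) & Fs (gs n) A (sgn s) = Fs (gs n) M 1].
Proof.
move=> NM h.
have [sg1 sg2] := sgn_sigma.
have sgM (p q : 'S_3) : sgn (p * q)%g = sgn p * sgn q by rewrite /sgn odd_permM signr_addb.
have sg0 : sgn 1%g = 1 by rewrite /sgn odd_perm1.
have P1 M' : Nplus M' -> Nplus (prime1 M') by case/primes_factor.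
have P2 M' : Nplus M' -> Nplus (prime2 M') by case/primes_factor.
have u1 : unit_exp 1 by left.
have uN1 : unit_exp (-1) by right.
by case: h; rewrite ?sgM ?sg1 ?sg2 ?sg0 ?mulrNN ?mulN1r ?mulr1 ?opprK;
  split; rewrite ?(Fs_prime1, Fs_prime2) ?opprK; auto.
Qed.

End Sums.

Theorem theorem2 (R : realType) (n : nat) (hn : (3 <= n)%N) (M : 'M[R]_n)
  (hM : Nplus M) (s1 s2 s3 s4 : 'S_3) (A1 A2 A3 A4 : 'M[R]_n)
  (h1 : s_image M s1 A1) (h2 : s_image M s2 A2)
  (h3 : s_image M s3 A3) (h4 : s_image M s4 A4) :
  [/\ dilog_sum (@YL R n) A1 (sgn s1) = dilog_sum (@tYU R n) A2 (sgn s2),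
      dilog_sum (@tYU R n) A2 (sgn s2) = dilog_sum (@tYL R n) A3 (sgn s3) &
      dilog_sum (@tYL R n) A3 (sgn s3) = dilog_sum (@YU R n) A4 (sgn s4)].
Proof.
have [N1 u1 E1] := Fs_s_image hM h1; have [N2 u2 E2] := Fs_s_image hM h2.
have [N3 u3 E3] := Fs_s_image hM h3; have [N4 u4 E4] := Fs_s_image hM h4.
rewrite dilog_sum_YL dilog_sum_tYU dilog_sum_tYL dilog_sum_YU.
rewrite -(Fs_gs_tau N2 u2) -(Fs_gs_ks N3 u3) -(Fs_gs_ks (Nplus_tau N4) u4).
by rewrite -(Fs_gs_tau N4 u4) E1 E2 E3 E4.
Qed.
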